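(* Let $k\ge1$, let $u$ be the solution of the boundary value problem $$-\varepsilon u''+a u'+c u=f \ \text{ in } (-1,1),\qquad u(-1)=u(1)=0,$$ and let $u_N\in V^N$ be the solution of the streamline-diffusion method of order $k$, $$B_{\mathrm{SD}}(u_N,v_N)=(f,v_N)+f_{\mathrm{Stab}}(v_N)\qquad\text{for all } v_N\in V^N,$$ on the piecewise equidistant mesh described in the context. Suppose the stabilisation parameters $\delta_i$, $i=-N+1,\dots,N$, satisfy both of the following: (1) $0\le\delta_i\le\frac12\min\left\{\frac{h_i^2}{\varepsilon c_{\mathrm{inv}}^2},\frac{\gamma}{\|c\|_\infty^2}\right\}$ for all $i$, or, in the case of linear elements ($k=1$), $0\le\delta_i\le\frac{\gamma}{2\|c\|_\infty^2}$ for all $i$; (2) $0\le\delta_i\le C_\delta\min\left\{1,\,h_i^2/\varepsilon\right\}$ for all $i$, with a constant $C_\delta$ independent of $\varepsilon$ and $N$. Then there is a constant $C>0$, independent of $\varepsilon$ and $N$, such that $$\|u-u_N\|_{\mathrm{SD}}\ \le\ C\left((\mathcal K+1)N^{-1}\right)^k\ \le\ C\left(N^{-1}\ln N\right)^k .$$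
   Context: **Problem and standing assumptions.** $\varepsilon\in(0,1]$ is a (small) perturbation parameter. The data $a,c,f$ are sufficiently smooth and satisfy on $[-1,1]$: $a(x)=-x\,b(x)$ with $b(x)>0$, $c(x)\ge 0$, $c(0)>0$. Moreover $\left(c-\tfrac12 a'\right)(x)\ge\gamma>0$ for all $x\in[-1,1]$, with a constant $\gamma$. **The exponent $\lambda$.** Put $\bar\lambda:=c(0)/|a'(0)|$. The parameter $\lambda$ satisfies $0<\lambda<\bar\lambda$ (or $\lambda=\bar\lambda$ if $\bar\lambda$ is not an integer); for such $\lambda$ the a priori bounds $|u^{(i)}(x)|\le C\left(1+(\varepsilon^{1/2}+|x|)^{\lambda-i}\right)$, $x\in[-1,1]$, are known to hold with $C$ independent of $\varepsilon$ for all derivative orders $i$ needed ($0\le i\le k+1$). It is assumed throughout that $\lambda\in(0,k+1)$. **Mesh.** Let $N$ be a positive integer, sufficiently large (dependent on $k$), and set $$\sigma=\max\left\{\varepsilon^{(1-\lambda/(k+1))/2},\,N^{-(2k+1)}\right\},\qquad \mathcal K=\left\lfloor 1-\frac{\ln\sigma}{\ln 10}\right\rfloor .$$ It is assumed that $N/(\mathcal K+1)$ is a (positive) integer. The interval $(0,1]$ is partitioned into the $\mathcal K+1$ subintervals $(0,10^{-\mathcal K}],(10^{-\mathcal K},10^{-\mathcal K+1}],\dots,(10^{-1},1]$, and each of these is divided uniformly into $N/(\mathcal K+1)$ parts. This gives mesh points $0=x_0<x_1<\dots<x_N=1$; the mesh is extended to $[-1,0]$ by symmetry, $x_{-i}=-x_i$.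 Put $I_i=(x_{i-1},x_i)$ and $h_i=x_i-x_{i-1}$ for $i=-N+1,\dots,N$. **Finite element space.** $V^N$ is the space of all $v\in C([-1,1])$ with $v(-1)=v(1)=0$ whose restriction to each $I_i$ is a polynomial of degree at most $k$. **Norms and forms.** $(\cdot,\cdot)$ and $\|\cdot\|$ are the inner product and norm of $L^2((-1,1))$, $\|\cdot\|_{I_i}$ is the norm of $L^2(I_i)$, $\|\cdot\|_\infty$ is the supremum norm on $(-1,1)$, $|v|_1:=\|v'\|$. Define $$B_\varepsilon(v,w):=(\varepsilon v',w')+(av',w)+(cv,w),\qquad B_{\mathrm{SD}}(v,w):=B_\varepsilon(v,w)+B_{\mathrm{Stab}}(v,w),$$ $$B_{\mathrm{Stab}}(v,w):=\sum_{i=-N+1}^N\delta_i\int_{x_{i-1}}^{x_i}\left(-\varepsilon v''+av'+cv\right)\,a w'\,dx,\qquad f_{\mathrm{Stab}}(w):=\sum_{i=-N+1}^N\delta_i\int_{x_{i-1}}^{x_i}f\,a w'\,dx,$$ $$\|v\|_{\mathrm{SD}}:=\left(\varepsilon|v|_1^2+\|v\|^2+\sum_{i=-N+1}^N\|\sqrt{\delta_i}\,a v'\|_{I_i}^2\right)^{1/2}.$$ $c_{\mathrm{inv}}$ is a constant, independent of $i$ and $h_i$, for which the inverse inequality $\|v_N''\|_{I_i}\le c_{\mathrm{inv}}h_i^{-1}\|v_N'\|_{I_i}$ holds for all $v_N\in V^N$. **Constants.** $C$ denotes a generic positive constant (possibly different at each occurrence) independent of $\varepsilon$ and $N$; it may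 depend on $a,c,f,\gamma,k,\lambda,c_{\mathrm{inv}},C_\delta$. *)

(* Defs.v *)
(* Real analysis over Stdlib's R with Coquelicot. *)
From Stdlib Require Export Reals.
From Coquelicot Require Export Coquelicot.
Open Scope R_scope.

(** ** Data and boundary value problem *)

(* Derivatives are two-sided, so at -1 and 1 they involve values of [g] just
   outside the interval.  This loses no generality: a function of class C^m on
   the closed interval has a C^m extension, and only values on [-1,1] matter. *)
Definition class_C (m : nat) (g : R -> R) : Prop :=
  forall (i : nat) (x : R), (i <= m)%nat -> -1 <= x <= 1 ->
    ex_derive_n g i x /\ continuous (Derive_n g i) x.

Definition continuous_I (g : R -> R) : Prop :=
  continuous_on (fun x : R => -1 <= x <= 1) g.

Definition bvp_solution (eps : R) (a c f u : R -> R) : Prop :=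
  continuous_I u /\ u (-1) = 0 /\ u 1 = 0 /\
  forall x : R, -1 < x < 1 ->
    ex_derive u x /\ ex_derive (Derive u) x /\
    - eps * Derive_n u 2 x + a x * Derive u x + c x * u x = f x.

Definition lambda_bar (a c : R -> R) : R := c 0 / Rabs (Derive a 0).

Definition is_integer (r : R) : Prop := exists z : Z, r = IZR z.

(* Stated on the open interval: [Derive_n u i] at -1 and 1 would depend on
   irrelevant values of [u] outside [-1,1]. *)
Definition a_priori_bounds (a c f : R -> R) (k : nat) (lambda : R) : Prop :=
  exists C : R, 0 < C /\
    forall (eps : R) (u : R -> R), 0 < eps <= 1 -> bvp_solution eps a c f u ->
    forall (i : nat) (x : R), (i <= k + 1)%nat -> -1 < x < 1 ->
      Rabs (Derive_n u i x)
        <= C * (1 + Rpower (sqrt eps + Rabs x) (lambda - INR i)).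

(** ** Mesh *)

Definition mesh_sigma (k : nat) (lambda eps : R) (N : nat) : R :=
  Rmax (Rpower eps ((1 - lambda / INR (k + 1)) / 2))
       (/ INR N ^ (2 * k + 1)).

(* The floor is at least 1 here, since 0 < sigma <= 1; [Z.to_nat] is harmless. *)
Definition mesh_K (k : nat) (lambda eps : R) (N : nat) : nat :=
  Z.to_nat (Int_part (1 - ln (mesh_sigma k lambda eps N) / ln 10)).

(* The breakpoints 0, 10^-K, 10^(-K+1), ..., 10^-1, 1, numbered 0, ..., K+1. *)
Definition breakpoint (K j : nat) : R :=
  match j with
  | O => 0
  | S j' => / 10 ^ (K - j')
  end.

(* x_i for 0 <= i <= N: the (i mod M)-th point of the uniform division of the
   (i / M)-th subinterval into M = N / (K+1) parts. *)
Definition half_mesh (K N i : nat) : R :=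
  let M := Nat.div N (K + 1) in
  let j := Nat.div i M in
  breakpoint K j
    + INR (Nat.modulo i M) / INR M * (breakpoint K (S j) - breakpoint K j).

Definition mesh (k : nat) (lambda eps : R) (N : nat) (i : Z) : R :=
  IZR (Z.sgn i) * half_mesh (mesh_K k lambda eps N) N (Z.abs_nat i).

Definition cell_index (N : nat) (i : Z) : Prop :=
  (- Z.of_nat N + 1 <= i <= Z.of_nat N)%Z.

Definition step (X : Z -> R) (i : Z) : R := X i - X (i - 1)%Z.

(* Sum over i = -N+1, ..., N, for N >= 1. *)
Definition sum_cells (N : nat) (F : Z -> R) : R :=
  sum_f_R0 (fun j : nat => F (Z.of_nat j - Z.of_nat N + 1)%Z) (2 * N - 1).

(** ** Finite element space on the mesh [X] *)

Definition fe_space (k N : nat) (X : Z -> R) (v : R -> R) : Prop :=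
  continuous_I v /\ v (-1) = 0 /\ v 1 = 0 /\
  forall i : Z, cell_index N i ->
    exists p : nat -> R, forall x : R, X (i - 1)%Z < x < X i ->
      v x = sum_f_R0 (fun j : nat => p j * x ^ j) k.

(** ** Norms and forms *)

(* The functions concerned are piecewise continuous, so the Riemann integral is
   the Lebesgue integral; values of derivatives at mesh points play no role. *)
Definition inner (v w : R -> R) : R := RInt (fun x => v x * w x) (-1) 1.

Definition norm_L2 (l r : R) (v : R -> R) : R :=
  sqrt (RInt (fun x => v x ^ 2) l r).

Definition seminorm1 (v : R -> R) : R := norm_L2 (-1) 1 (Derive v).

Definition sup_norm (g : R -> R) : R :=
  real (Lub_Rbar (fun y : R => exists x : R, -1 < x < 1 /\ y = Rabs (g x))).

Definition B_eps (eps : R) (a c v w : R -> R) : R :=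
  inner (fun x => eps * Derive v x) (Derive w)
  + inner (fun x => a x * Derive v x) w
  + inner (fun x => c x * v x) w.

Definition B_stab (eps : R) (a c : R -> R) (N : nat) (X delta : Z -> R)
    (v w : R -> R) : R :=
  sum_cells N (fun i =>
    delta i * RInt (fun x =>
      (- eps * Derive_n v 2 x + a x * Derive v x + c x * v x)
      * (a x * Derive w x)) (X (i - 1)%Z) (X i)).

Definition f_stab (a f : R -> R) (N : nat) (X delta : Z -> R) (w : R -> R) : R :=
  sum_cells N (fun i =>
    delta i * RInt (fun x => f x * (a x * Derive w x)) (X (i - 1)%Z) (X i)).

Definition B_SD (eps : R) (a c : R -> R) (N : nat) (X delta : Z -> R)
    (v w : R -> R) : R :=
  B_eps eps a c v w + B_stab eps a c N X delta v w.

Definition norm_SD (eps : R) (a : R -> R) (N : nat) (X delta : Z -> R)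
    (v : R -> R) : R :=
  sqrt (eps * seminorm1 v ^ 2 + norm_L2 (-1) 1 v ^ 2
        + sum_cells N (fun i =>
            norm_L2 (X (i - 1)%Z) (X i)
              (fun x => sqrt (delta i) * (a x * Derive v x)) ^ 2)).

Definition sd_solution (eps : R) (a c f : R -> R) (k N : nat) (X delta : Z -> R)
    (uN : R -> R) : Prop :=
  fe_space k N X uN /\
  forall v : R -> R, fe_space k N X v ->
    B_SD eps a c N X delta uN v = inner f v + f_stab a f N X delta v.

Definition inverse_inequality (cinv : R) (k N : nat) (X : Z -> R) : Prop :=
  forall (i : Z) (v : R -> R), cell_index N i -> fe_space k N X v ->
    norm_L2 (X (i - 1)%Z) (X i) (Derive_n v 2)
      <= cinv * / step X i * norm_L2 (X (i - 1)%Z) (X i) (Derive v).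

(** ** Conditions on the stabilisation parameters *)

Definition delta_coercivity (eps gamma cinv : R) (c : R -> R) (k N : nat)
    (X delta : Z -> R) : Prop :=
  (forall i : Z, cell_index N i ->
     0 <= delta i
       <= 1 / 2 * Rmin (step X i ^ 2 / (eps * cinv ^ 2))
                       (gamma / sup_norm c ^ 2))
  \/
  (k = 1%nat /\
   forall i : Z, cell_index N i ->
     0 <= delta i <= gamma / (2 * sup_norm c ^ 2)).

Definition delta_size (eps Cdelta : R) (N : nat) (X delta : Z -> R) : Prop :=
  forall i : Z, cell_index N i ->
    0 <= delta i <= Cdelta * Rmin 1 (step X i ^ 2 / eps).

(* Main.v *)
(** Galerkin orthogonality and coercivity bound [uI - uN] by [u - uI] for any
    [uI] in the finite element space agreeing with [u] at the mesh points.
    Everything is done cell by cell: Young's inequality under the integral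
    replaces Cauchy-Schwarz, and what remains is a pointwise bound of
    [eps (u-uI)'^2 + (x (u-uI)')^2 + (u-uI)^2 + delta eps^2 (u-uI)''^2].

    On a cell of length [h] lying in [|x| <= 10 tau], with [h <= 9 H tau] and
    [H = (K+1)/N], take for [uI] the Taylor polynomial at the midpoint plus an
    affine correction; the error terms are O(H^(2k)) as soon as
    [sqrt eps <= tau] and [tau^(k+1) |u^(k+1)| <= C].  Away from 0,
    [tau = sqrt eps + dist(0, cell)] does.  In the innermost subinterval [tau = sigma]
    does if [sigma = eps^((1 - lambda/(k+1))/2)]; if [sigma = N^-(2k+1)] instead,
    affine interpolation has a bounded error there, which is enough because that
    subinterval is so short. *)

Require Import Defs.
From Stdlib Require Import Lra Lia Psatz ZArith.

(** The estimate is scale invariant. With [|u^(k+1)| <= C tau^-(k+1)] the error of [u'] on a cell is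
    of size [h^k tau^-(k+1)], and one factor [tau] makes it [(h/tau)^k <= (9 H)^k], whatever the
    position of the cell. That factor is always available: [sqrt eps <= tau] supplies it in the
    diffusion term, and in the convection term [a = -x b] with [|x| <= 10 tau] does. Hence
    [a (u-uI)'] can be paired directly with the test function in L2, without integrating by parts
    and without losing an order. The exponent in [N^-(2k+1)] splits as [2k] for the square of the
    wanted rate and 1 for the factor [N] by which the weight [/ (N h)] exceeds [/ h]'s share of a
    single cell. The technical obstacle is that [Derive] is total: its values at mesh points and at
    -1 and 1 are uncontrolled, and the equation is known only inside the interval. Functions are
    therefore compared with functions continuous on the whole line that agree with them on an open
    cell, and the continuity of [u'] and [u''] up to the boundary has to be derived from the
    equation. *)

(** * Continuity on the closed interval, and functions with a continuous extension *)

Lemma continuous_nonexpansive (g : R -> R) (x : R) :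
  (forall y z, Rabs (g y - g z) <= Rabs (y - z)) -> continuous g x.
Proof.
  intros Hg P [d Hd]. exists d. intros y Hy. apply Hd.
  apply Rle_lt_trans with (2 := Hy). apply Hg.
Qed.

Lemma continuous_Rmin_l (c x : R) : continuous (fun y => Rmin y c) x.
Proof.
  apply continuous_nonexpansive; intros y z.
  unfold Rmin, Rabs; repeat destruct Rle_dec; repeat destruct Rcase_abs; lra.
Qed.

Lemma continuous_Rmax_l (c x : R) : continuous (fun y => Rmax y c) x.
Proof.
  apply continuous_nonexpansive; intros y z.
  unfold Rmax, Rabs; repeat destruct Rle_dec; repeat destruct Rcase_abs; lra.
Qed.

(** Composition with this retraction onto [-1,1] turns a function continuous only relative to the
    interval into one continuous on the whole line, without changing it on the interval. *)
Definition clamp (x : R) : R := Rmax (Rmin x 1) (-1).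

Lemma clamp_id (x : R) : -1 <= x <= 1 -> clamp x = x.
Proof. intros H; unfold clamp; rewrite Rmin_left, Rmax_left; lra. Qed.

Lemma clamp_range (x : R) : -1 <= clamp x <= 1.
Proof. unfold clamp, Rmax, Rmin; repeat destruct Rle_dec; lra. Qed.

Lemma continuous_clamp (x : R) : continuous clamp x.
Proof.
  apply (continuous_comp (fun y => Rmin y 1) (fun y => Rmax y (-1))).
  apply continuous_Rmin_l. apply continuous_Rmax_l.
Qed.

Lemma continuous_comp_clamp (g : R -> R) (x : R) :
  continuous_I g -> continuous (fun y => g (clamp y)) x.
Proof.
  intros Hg P HP.
  specialize (Hg (clamp x) (clamp_range x) P HP).
  unfold filtermap, within in *.
  generalize (continuous_clamp x _ Hg).
  unfold filtermap. apply filter_imp.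
  intros y Hy; apply Hy, clamp_range.
Qed.

Lemma continuous_I_of_pt (g : R -> R) :
  (forall x, -1 <= x <= 1 -> continuous g x) -> continuous_I g.
Proof.
  intros Hg x Hx. apply filterlim_filter_le_1 with (2 := Hg x Hx).
  intros P. apply filter_le_within.
Qed.

Lemma bounded_continuous_I (g : R -> R) :
  continuous_I g -> exists M, 0 < M /\ forall x, -1 <= x <= 1 -> Rabs (g x) <= M.
Proof.
  intros Hg.
  destruct (continuity_ab_maj (fun y => Rabs (g (clamp y))) (-1) 1) as [z [Hz _]].
  lra.
  intros y _. apply continuity_pt_filterlim.
  apply (continuous_comp (fun y => g (clamp y)) Rabs).
  now apply continuous_comp_clamp.
  apply continuous_Rabs.
  exists (Rabs (g (clamp z)) + 1). split.
  generalize (Rabs_pos (g (clamp z))); lra.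
  intros x Hx. generalize (Hz x Hx); rewrite (clamp_id x Hx); lra.
Qed.

(** The derivative of a piecewise polynomial has arbitrary values at mesh points. Agreement on the
    open cell with a globally continuous function still gives Riemann integrability, and the
    property is stable under sums, differences and products. *)
Definition extends (l r : R) (w : R -> R) : Prop :=
  exists g : R -> R,
    (forall x, continuous g x) /\ forall x, l < x < r -> w x = g x.

Section Extends.

Variables l r : R.

Lemma extends_ext (v w : R -> R) :
  (forall x, l < x < r -> v x = w x) -> extends l r v -> extends l r w.
Proof.
  intros E [g [Hg H]]. exists g; split; trivial.
  intros x Hx; rewrite <- E; auto.
Qed.

Lemma extends_const (d : R) : extends l r (fun _ => d).
Proof. exists (fun _ => d); split; auto. intros; apply continuous_const. Qed.

Lemma extends_id : extends l r (fun x => x).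
Proof. exists (fun x => x); split; auto. intros; apply continuous_id. Qed.

Lemma extends_plus (v w : R -> R) :
  extends l r v -> extends l r w -> extends l r (fun x => v x + w x).
Proof.
  intros [g [Hg H]] [g' [Hg' H']]. exists (fun x => g x + g' x); split.
  intros x; apply (continuous_plus g g'); auto.
  intros x Hx; rewrite H, H'; auto.
Qed.

Lemma extends_mult (v w : R -> R) :
  extends l r v -> extends l r w -> extends l r (fun x => v x * w x).
Proof.
  intros [g [Hg H]] [g' [Hg' H']]. exists (fun x => g x * g' x); split.
  intros x; apply (continuous_mult g g'); auto.
  intros x Hx; rewrite H, H'; auto.
Qed.

Lemma extends_minus (v w : R -> R) :
  extends l r v -> extends l r w -> extends l r (fun x => v x - w x).
Proof.
  intros Hv Hw. apply extends_ext with (fun x => v x + (-1) * w x).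
  intros; lra.
  apply extends_plus; auto. apply extends_mult; auto. apply extends_const.
Qed.

Lemma extends_sqr (v : R -> R) :
  extends l r v -> extends l r (fun x => v x ^ 2).
Proof.
  intros Hv. apply extends_ext with (fun x => v x * v x).
  intros; lra. now apply extends_mult.
Qed.

Lemma extends_ex_RInt (v : R -> R) : l <= r -> extends l r v -> ex_RInt v l r.
Proof.
  intros Hlr [g [Hg H]]. apply ex_RInt_ext with g.
  rewrite Rmin_left, Rmax_right by lra. intros; symmetry; auto.
  apply (ex_RInt_continuous (V:=R_CompleteNormedModule)). auto.
Qed.

End Extends.

Lemma extends_continuous_I (l r : R) (g : R -> R) :
  -1 <= l -> r <= 1 -> continuous_I g -> extends l r g.
Proof.
  intros Hl Hr Hg. exists (fun y => g (clamp y)); split.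
  intros x; now apply continuous_comp_clamp.
  intros x Hx; rewrite clamp_id; auto; lra.
Qed.

(** * Calculus with derivatives known only inside an interval, and functions that are C2 on a
    cell *)

Lemma locally_open (l r x : R) (P : R -> Prop) :
  l < x < r -> (forall y, l < y < r -> P y) -> locally x P.
Proof.
  intros Hx HP. apply locally_interval with l r; simpl; try apply Hx.
  intros; apply HP; split; assumption.
Qed.

Lemma MVT_open (F F' : R -> R) (l r : R) :
  l < r -> (forall x, l <= x <= r -> continuous F x) ->
  (forall x, l < x < r -> is_derive F x (F' x)) ->
  exists xi, l < xi < r /\ F r - F l = F' xi * (r - l).
Proof.
  intros Hlr HF HF'.
  assert (pr1 : forall c, l < c < r -> derivable_pt F c).
  { intros c Hc. exists (F' c). now apply is_derive_Reals, HF'. }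
  destruct (MVT F id l r pr1 (fun c _ => derivable_pt_id c) Hlr) as [c [Hc E]].
  intros; apply continuity_pt_filterlim, HF; auto.
  intros; apply derivable_continuous_pt, derivable_pt_id.
  exists c; split; trivial.
  rewrite derive_pt_id in E. unfold id in E.
  rewrite Derive_Reals in E.
  rewrite (is_derive_unique _ _ _ (HF' c Hc)) in E. lra.
Qed.

Lemma constant_open (F : R -> R) (l r x y : R) :
  (forall z, l < z < r -> is_derive F z 0) -> l < x < r -> l < y < r ->
  F x = F y.
Proof.
  intros HF.
  assert (H : forall x y, l < x < r -> l < y < r -> x < y -> F x = F y).
  { intros s t Hs Ht Hst.
    destruct (MVT_open F (fun _ => 0) s t Hst) as [xi [_ E]].
    intros z Hz. apply (ex_derive_continuous F). exists 0; apply HF; lra.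
    intros z Hz; apply HF; lra.
    lra. }
  intros Hx Hy. destruct (Rtotal_order x y) as [L|[L|L]].
  now apply H. now subst. symmetry; now apply H.
Qed.

Lemma is_derive_RInt_continuous (g : R -> R) (a x : R) :
  (forall y, continuous g y) -> is_derive (fun t => RInt g a t) x (g x).
Proof.
  intros Hg. apply (is_derive_RInt g _ a); auto.
  apply filter_forall; intros y. apply (RInt_correct (V:=R_CompleteNormedModule)).
  apply (ex_RInt_continuous (V:=R_CompleteNormedModule)); auto.
Qed.

(** [F'] may be wild at the end points, so it is replaced under the integral by the continuous [G].
    Then [F] minus the primitive of [G] has derivative 0 inside, and the mean value theorem equates
    its two end values. *)
Lemma FTC_open (F F' G : R -> R) (l r : R) :
  l < r -> (forall x, l <= x <= r -> continuous F x) ->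
  (forall x, l < x < r -> is_derive F x (F' x)) ->
  (forall x, continuous G x) -> (forall x, l < x < r -> F' x = G x) ->
  RInt F' l r = F r - F l.
Proof.
  intros Hlr HF HF' HG E.
  rewrite (RInt_ext F' G).
  2: rewrite Rmin_left, Rmax_right by lra; auto.
  destruct (MVT_open (fun x => F x - RInt G l x) (fun x => F' x - G x) l r Hlr)
    as [xi [Hxi H]].
  - intros x Hx. apply (continuous_minus F (fun x => RInt G l x)). auto.
    apply (ex_derive_continuous (fun x => RInt G l x)).
    exists (G x). now apply is_derive_RInt_continuous.
  - intros x Hx. apply (is_derive_minus F (fun x => RInt G l x)). auto.
    now apply is_derive_RInt_continuous.
  - rewrite E in H by trivial. rewrite (RInt_point l G) in H.
    change (zero : R) with 0 in H. lra.
Qed.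
(** The function itself is matched on the closed cell, because integration by parts needs its end
    values; derivatives are matched only inside, where [Derive] is meaningful. The representatives
    are continuous on the whole line. *)
Definition C2_cell (l r : R) (v : R -> R) : Prop :=
  exists p0 p1 p2 : R -> R,
    (forall x, continuous p0 x) /\ (forall x, continuous p1 x) /\
    (forall x, continuous p2 x) /\ (forall x, l <= x <= r -> v x = p0 x) /\
    (forall x, l < x < r -> is_derive p0 x (p1 x)) /\
    (forall x, l < x < r -> is_derive p1 x (p2 x)).

Lemma is_derive_ext_open (l r x d : R) (f g : R -> R) :
  l < x < r -> (forall y, l < y < r -> f y = g y) ->
  is_derive f x d -> is_derive g x d.
Proof.
  intros Hx E. apply is_derive_ext_loc. now apply (locally_open l r).
Qed.

Section C2Cell.

Variables l r : R.

(** An open cell is a neighbourhood of each of its points, so agreement there carries over to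
    [Derive] and, used a second time, to [Derive_n v 2]. *)
Lemma derivatives_on_cell (v p0 p1 p2 : R -> R) :
  (forall x, l < x < r -> v x = p0 x) ->
  (forall x, l < x < r -> is_derive p0 x (p1 x)) ->
  (forall x, l < x < r -> is_derive p1 x (p2 x)) ->
  forall x, l < x < r ->
    Derive v x = p1 x /\ Derive_n v 2 x = p2 x /\
    is_derive v x (p1 x) /\ is_derive (Derive v) x (p2 x).
Proof.
  intros E0 E1 E2.
  assert (D : forall x, l < x < r -> is_derive v x (p1 x)).
  { intros x Hx. apply (is_derive_ext_open l r) with p0; auto.
    intros; symmetry; auto. }
  assert (D' : forall x, l < x < r -> Derive v x = p1 x).
  { intros x Hx. now apply is_derive_unique, D. }
  intros x Hx.
  assert (D2 : is_derive (Derive v) x (p2 x)).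
  { apply (is_derive_ext_open l r) with p1; auto. intros; symmetry; auto. }
  split; [auto | split; [now apply is_derive_unique | auto]].
Qed.

Lemma C2_cell_regular (v : R -> R) :
  C2_cell l r v ->
  extends l r v /\ extends l r (Derive v) /\ extends l r (Derive_n v 2) /\
  forall x, l < x < r ->
    is_derive v x (Derive v x) /\ is_derive (Derive v) x (Derive_n v 2 x).
Proof.
  intros (p0 & p1 & p2 & C0 & C1 & C2 & E0 & E1 & E2).
  assert (D : forall x, l < x < r -> Derive v x = p1 x /\ Derive_n v 2 x = p2 x /\
    is_derive v x (p1 x) /\ is_derive (Derive v) x (p2 x)).
  { apply derivatives_on_cell with p0; auto. intros; apply E0; lra. }
  split; [|split; [|split]].
  - exists p0; split; auto; intros; apply E0; lra.
  - exists p1; split; auto; intros; now apply D.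
  - exists p2; split; auto; intros; now apply D.
  - intros x Hx. destruct (D x Hx) as (F1 & F2 & F3 & F4).
    rewrite F1, F2. auto.
Qed.

Lemma C2_cell_minus (v w : R -> R) :
  C2_cell l r v -> C2_cell l r w ->
  C2_cell l r (fun x => v x - w x) /\
  forall x, l < x < r ->
    Derive (fun y => v y - w y) x = Derive v x - Derive w x /\
    Derive_n (fun y => v y - w y) 2 x = Derive_n v 2 x - Derive_n w 2 x.
Proof.
  intros Hv Hw.
  destruct (C2_cell_regular v Hv) as (_ & _ & _ & Dv).
  destruct (C2_cell_regular w Hw) as (_ & _ & _ & Dw).
  split.
  - destruct Hv as (p0 & p1 & p2 & C0 & C1 & C2 & E0 & E1 & E2).
    destruct Hw as (q0 & q1 & q2 & B0 & B1 & B2 & F0 & F1 & F2).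
    exists (fun x => p0 x - q0 x), (fun x => p1 x - q1 x), (fun x => p2 x - q2 x).
    split; [|split; [|split; [|split; [|split]]]]; intros x;
      try (apply (continuous_minus (V:=R_NormedModule)); auto).
    + intros Hx; rewrite E0, F0; auto.
    + intros Hx; apply (is_derive_minus p0 q0); auto.
    + intros Hx; apply (is_derive_minus p1 q1); auto.
  - intros x Hx.
    destruct (derivatives_on_cell (fun y => v y - w y) (fun y => v y - w y)
      (fun y => Derive v y - Derive w y) (fun y => Derive_n v 2 y - Derive_n w 2 y))
      with (x := x) as (A & B & _); auto.
    + intros y Hy. exact (is_derive_minus v w _ _ _ (proj1 (Dv y Hy)) (proj1 (Dw y Hy))).
    + intros y Hy. exact (is_derive_minus _ _ _ _ _ (proj2 (Dv y Hy)) (proj2 (Dw y Hy))).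
Qed.

End C2Cell.

(** * Polynomials of degree at most [k] *)

Definition polyfun (k : nat) (v : R -> R) : Prop :=
  exists p : nat -> R, forall x, v x = sum_f_R0 (fun j => p j * x ^ j) k.

Lemma polyfun_ext (k : nat) (v w : R -> R) :
  (forall x, v x = w x) -> polyfun k v -> polyfun k w.
Proof. intros E [p H]; exists p; intros x; now rewrite <- E. Qed.

Lemma polyfun_S (k : nat) (v : R -> R) : polyfun k v -> polyfun (S k) v.
Proof.
  intros [p H]. exists (fun j => if (j <=? k)%nat then p j else 0).
  intros x. simpl sum_f_R0.
  replace (match k with 0%nat => false | S m' => (k <=? m')%nat end) with false
    by (destruct k; auto; symmetry; apply Nat.leb_gt; lia).
  rewrite Rmult_0_l, Rplus_0_r, H. apply sum_eq.
  intros i Hi. apply Nat.leb_le in Hi. now rewrite Hi.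
Qed.

Lemma polyfun_le (k k' : nat) (v : R -> R) :
  (k <= k')%nat -> polyfun k v -> polyfun k' v.
Proof. induction 1; auto using polyfun_S. Qed.

Lemma polyfun_plus (k : nat) (v w : R -> R) :
  polyfun k v -> polyfun k w -> polyfun k (fun x => v x + w x).
Proof.
  intros [p H] [q H']. exists (fun j => p j + q j). intros x.
  rewrite H, H', <- sum_plus. apply sum_eq; intros; ring.
Qed.

Lemma polyfun_scal (k : nat) (v : R -> R) (d : R) :
  polyfun k v -> polyfun k (fun x => d * v x).
Proof.
  intros [p H]. exists (fun j => d * p j). intros x.
  rewrite H, scal_sum. apply sum_eq; intros; ring.
Qed.

Lemma polyfun_const (k : nat) (d : R) : polyfun k (fun _ => d).
Proof.
  apply polyfun_le with 0%nat. lia. exists (fun _ => d); intros; simpl; ring.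
Qed.

Lemma polyfun_mul_X (k : nat) (v : R -> R) :
  polyfun k v -> polyfun (S k) (fun x => x * v x).
Proof.
  intros [p H]. exists (fun j => match j with O => 0 | S i => p i end).
  intros x. rewrite decomp_sum by lia. simpl pred. rewrite H, scal_sum.
  rewrite Rmult_0_l, Rplus_0_l. apply sum_eq; intros; simpl; ring.
Qed.

Lemma polyfun_shift_pow (k : nat) (m : R) : polyfun k (fun x => (x - m) ^ k).
Proof.
  induction k.
  - exists (fun _ => 1); intros; simpl; ring.
  - apply polyfun_ext with (fun x => x * (x - m) ^ k + (- m) * (x - m) ^ k).
    intros; simpl; ring.
    apply polyfun_plus. now apply polyfun_mul_X.
    apply polyfun_S. now apply polyfun_scal.
Qed.

Lemma polyfun_derive (k : nat) (v : R -> R) :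
  polyfun k v -> exists w, polyfun k w /\ forall x, is_derive v x (w x).
Proof.
  intros [p H].
  assert (G : exists w, polyfun k w /\
    forall x, is_derive (fun y => sum_f_R0 (fun j => p j * y ^ j) k) x (w x)).
  { clear v H. induction k.
    - exists (fun _ => 0); split. apply polyfun_const.
      intros x; simpl. auto_derive; auto; ring.
    - destruct IHk as [w [Hw D]].
      (* The power is written [(x - 0) ^ k] so that [polyfun_shift_pow] applies. *)
      exists (fun x => w x + p (S k) * (INR (S k) * (x - 0) ^ k)); split.
      + apply polyfun_S, polyfun_plus; auto.
        apply polyfun_scal, polyfun_scal, polyfun_shift_pow.
      + intros x. apply (is_derive_plus
          (fun y => sum_f_R0 (fun j => p j * y ^ j) k) (fun y => p (S k) * y ^ S k)).
        auto.
        replace (p (S k) * (INR (S k) * (x - 0) ^ k))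
          with (p (S k) * (INR (S k) * 1 * x ^ pred (S k)))
          by (rewrite Rminus_0_r, Rmult_1_r; reflexivity).
        apply (is_derive_scal (fun y => y ^ S k)).
        apply (is_derive_pow (fun y => y) (S k) x 1). apply (is_derive_id x). }
  destruct G as [w [Hw D]]. exists w; split; auto.
  intros x. apply is_derive_ext with (2 := D x). intros; now rewrite H.
Qed.

Lemma polyfun_C2 (k : nat) (v : R -> R) :
  polyfun k v -> exists v1 v2, polyfun k v1 /\ polyfun k v2 /\
    (forall x, is_derive v x (v1 x)) /\ (forall x, is_derive v1 x (v2 x)) /\
    (forall x, continuous v x) /\ (forall x, continuous v1 x) /\
    (forall x, continuous v2 x).
Proof.
  intros Hv.
  destruct (polyfun_derive k v Hv) as [v1 [H1 D1]].
  destruct (polyfun_derive k v1 H1) as [v2 [H2 D2]].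
  destruct (polyfun_derive k v2 H2) as [v3 [H3 D3]].
  exists v1, v2; do 4 (split; [assumption|]).
  split; [|split]; intros x; apply (ex_derive_continuous (V:=R_NormedModule));
    eexists; eauto.
Qed.

Lemma polyfun_C2_cell (k : nat) (l r : R) (v p : R -> R) :
  polyfun k p -> (forall x, l <= x <= r -> v x = p x) -> C2_cell l r v.
Proof.
  intros Hp E. destruct (polyfun_C2 k p Hp) as (p1 & p2 & _ & _ & D1 & D2 & C0 & C1 & C2).
  exists p, p1, p2. do 5 (split; [now auto|]). auto.
Qed.

Lemma affine_C2_cell (l r : R) (v p : R -> R) :
  polyfun 1 p -> (forall x, l < x < r -> v x = p x) ->
  forall x, l < x < r -> Derive_n v 2 x = 0.
Proof.
  intros [q Hq] E x Hx.
  apply (derivatives_on_cell l r v p (fun _ => q 1%nat) (fun _ => 0)); auto.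
  - intros y Hy. apply is_derive_ext with (fun x => q 0%nat + q 1%nat * x).
    intros t; rewrite Hq; simpl; ring. auto_derive; auto; ring.
  - intros y Hy. auto_derive; auto.
Qed.

(** * Taylor polynomials and interpolants on a cell *)

Fixpoint taylor (c : nat -> R) (m : R) (n : nat) (x : R) : R :=
  match n with
  | O => 0
  | S n' => taylor c m n' x + c n' / INR (fact n') * (x - m) ^ n'
  end.

(** The entry [c j] stands for the [j]-th derivative at [m] and [n] counts terms, not the degree; so
    differentiation just shifts [c] and drops one term. *)
Lemma is_derive_taylor (c : nat -> R) (m : R) (n : nat) (x : R) :
  is_derive (taylor c m (S n)) x (taylor (fun j => c (S j)) m n x).
Proof.
  induction n.
  - simpl. auto_derive; auto; ring.
  - apply (is_derive_plus (taylor c m (S n))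
      (fun y => c (S n) / INR (fact (S n)) * (y - m) ^ S n)). exact IHn.
    replace (c (S n) / INR (fact n) * (x - m) ^ n)
      with (c (S n) / INR (fact (S n)) * (INR (S n) * 1 * (x - m) ^ pred (S n))).
    apply (is_derive_scal (fun y => (y - m) ^ S n)).
    apply (is_derive_pow (fun y => y - m) (S n) x 1).
    auto_derive; auto; ring.
    rewrite fact_simpl, mult_INR. simpl pred. field. split.
    apply INR_fact_neq_0. apply not_0_INR; lia.
Qed.

Lemma taylor_center (c : nat -> R) (m : R) (n : nat) : taylor c m (S n) m = c 0%nat.
Proof.
  induction n.
  - simpl; field.
  - change (taylor c m (S n) m + c (S n) / INR (fact (S n)) * (m - m) ^ S n = c 0%nat).
    rewrite IHn, Rminus_diag, pow_i by lia. ring.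
Qed.

Lemma polyfun_taylor (c : nat -> R) (m : R) (k : nat) : polyfun k (taylor c m (S k)).
Proof.
  assert (H : forall n, (n <= S k)%nat -> polyfun k (taylor c m n)).
  { induction n; intros Hn. apply polyfun_const.
    apply (polyfun_plus k (taylor c m n)
      (fun x => c n / INR (fact n) * (x - m) ^ n)). apply IHn; lia.
    apply polyfun_scal, polyfun_le with n. lia. apply polyfun_shift_pow. }
  apply H; lia.
Qed.

(** The derivative of the remainder is the remainder of the shifted family, and the remainder
    vanishes at [m]; one mean value step per order yields one factor [r - l]. The factorial of the
    sharp bound is given away. A family [U] replaces the derivatives of one function so that the
    induction can shift it. *)
Lemma taylor_remainder (l r m M : R) (n : nat) (U : nat -> R -> R) :
  l < m < r ->
  (forall j x, (j < n)%nat -> l < x < r -> is_derive (U j) x (U (S j) x)) ->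
  (forall x, l < x < r -> Rabs (U n x) <= M) ->
  forall x, l < x < r ->
    Rabs (U 0%nat x - taylor (fun j => U j m) m n x) <= M * (r - l) ^ n.
Proof.
  intros Hm. revert U. induction n; intros U HU HM x Hx.
  - simpl. rewrite Rminus_0_r, Rmult_1_r. auto.
  - set (F := fun y => U 0%nat y - taylor (fun j => U j m) m (S n) y).
    set (F' := fun y => U 1%nat y - taylor (fun j => U (S j) m) m n y).
    assert (D : forall y, l < y < r -> is_derive F y (F' y)).
    { intros y Hy. apply (is_derive_minus (U 0%nat)). apply HU; auto; lia.
      apply (is_derive_taylor (fun j => U j m)). }
    assert (B : forall y, l < y < r -> Rabs (F' y) <= M * (r - l) ^ n).
    { apply (IHn (fun j => U (S j))); auto. intros; apply HU; auto; lia. }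
    assert (Fm : F m = 0).
    { unfold F. rewrite taylor_center. ring. }
    change (Rabs (F x) <= M * (r - l) ^ S n).
    assert (S : forall s t, l < s < r -> l < t < r -> s < t ->
              Rabs (F t - F s) <= M * (r - l) ^ S n).
    { intros s t Hs Ht Hst.
      destruct (MVT_open F F' s t Hst) as [xi [Hxi ->]].
      intros z Hz. apply (ex_derive_continuous F). exists (F' z); apply D; lra.
      intros z Hz; apply D; lra.
      rewrite Rabs_mult, (Rabs_right (t - s)) by lra.
      replace (M * (r - l) ^ S n) with ((M * (r - l) ^ n) * (r - l)) by (simpl; ring).
      apply Rmult_le_compat; try apply Rabs_pos; try lra. apply B; lra. }
    destruct (Rtotal_order x m) as [L|[L|L]].
    + generalize (S x m Hx Hm L). rewrite Fm, Rabs_minus_sym, Rminus_0_r; auto.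
    + subst x. rewrite Fm, Rabs_R0. apply Rmult_le_pos.
      apply Rle_trans with (2 := HM m Hm), Rabs_pos. apply pow_le; lra.
    + generalize (S m x Hm Hx L). rewrite Fm, Rminus_0_r; auto.
Qed.

Lemma bound_closed_interval (g : R -> R) (l r E : R) :
  l < r -> (forall x, continuous g x) ->
  (forall x, l < x < r -> Rabs (g x) <= E) ->
  forall x, l <= x <= r -> Rabs (g x) <= E.
Proof.
  intros Hlr Hg HE x Hx. apply le_epsilon. intros e He.
  destruct (Hg x (ball (g x) (mkposreal e He)) (locally_ball _ _)) as [d Hd].
  (* [y] below lies a fraction [t] of the way from [x] to the midpoint: [t > 0] puts it inside the
     interval, and [t * (r - l) <= d / 2] keeps it within [d] of [x]. *)
  set (t := Rmin (1 / 2) (d / (2 * (r - l)))).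
  assert (Ht : 0 < t <= 1 / 2 /\ t * (r - l) <= d / 2).
  { destruct d as [d Hd']; unfold t; simpl.
    assert (0 < d / (2 * (r - l))) by (apply Rdiv_lt_0_compat; lra).
    split. split. apply Rmin_glb_lt; lra. apply Rmin_l.
    apply Rle_trans with (d / (2 * (r - l)) * (r - l)).
    apply Rmult_le_compat_r. lra. apply Rmin_r.
    right; field; lra. }
  set (y := x + t * ((l + r) / 2 - x)).
  assert (Hy : l < y < r) by (unfold y; nra).
  assert (B : Rabs (g y - g x) < e).
  { apply (Hd y). change (Rabs (y - x) < d).
    replace (y - x) with (t * ((l + r) / 2 - x)) by (unfold y; ring).
    assert (0 < d) by apply cond_pos.
    apply Rabs_def1; nra. }
  generalize (HE y Hy).
  replace (g x) with (g y - (g y - g x)) by ring.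
  generalize (Rabs_triang (g y) (- (g y - g x))). rewrite Rabs_Ropp.
  unfold Rminus at 1 2 3. intros; unfold Rminus in *; lra.
Qed.

Lemma affine_polyfun (A l s : R) : polyfun 1 (fun x => A + s * (x - l)).
Proof.
  apply polyfun_ext with (fun x => A + s * (x - l) ^ 1). intros; ring.
  apply polyfun_plus. apply polyfun_const. apply polyfun_scal, polyfun_shift_pow.
Qed.

Lemma derivatives_add_affine (T T1 T2 : R -> R) (A l s x : R) :
  (forall y, is_derive T y (T1 y)) -> (forall y, is_derive T1 y (T2 y)) ->
  Derive (fun y => T y + (A + s * (y - l))) x = T1 x + s /\
  Derive_n (fun y => T y + (A + s * (y - l))) 2 x = T2 x.
Proof.
  intros D1 D2.
  destruct (derivatives_on_cell (x - 1) (x + 1) (fun y => T y + (A + s * (y - l)))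
    (fun y => T y + (A + s * (y - l))) (fun y => T1 y + s) T2) with (x := x)
    as (E1 & E2 & _); auto; try lra.
  - intros y _. apply (is_derive_plus T (fun y => A + s * (y - l))). auto.
    auto_derive; auto; ring.
  - intros y _. replace (T2 y) with (T2 y + 0) by ring.
    apply (is_derive_plus T1 (fun _ => s)). auto. apply (is_derive_const s).
Qed.

(** The affine correction restores the end values, which makes neighbouring pieces fit, and leaves
    second derivatives alone. It is built from the two end errors, each at most [E], so its value at
    [l] costs [E] and its increment [2 E]: hence 4 = 1 + 1 + 2 for the function and 3 = 1 + 2 for
    the derivative. The representative [uc] carries the interior Taylor bound to the end points. *)
Lemma taylor_interpolant (k : nat) (u uc : R -> R) (l r M : R) :
  l < r -> (forall x, continuous uc x) -> (forall x, l <= x <= r -> u x = uc x) ->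
  (forall j x, (j <= S k)%nat -> l < x < r ->
     is_derive (Derive_n u j) x (Derive_n u (S j) x)) ->
  (forall x, l < x < r -> Rabs (Derive_n u (S (S k)) x) <= M) ->
  exists p, polyfun (S k) p /\ p l = u l /\ p r = u r /\
    forall x, l < x < r ->
      Rabs (u x - p x) <= 4 * M * (r - l) ^ S (S k) /\
      Rabs (Derive u x - Derive p x) <= 3 * M * (r - l) ^ S k /\
      Rabs (Derive_n u 2 x - Derive_n p 2 x) <= M * (r - l) ^ k.
Proof.
  intros Hlr Huc Eu HU HM.
  set (m := (l + r) / 2). assert (Hm : l < m < r) by (unfold m; lra).
  set (T := taylor (fun j => Derive_n u j m) m (S (S k))).
  set (T1 := taylor (fun j => Derive_n u (S j) m) m (S k)).
  set (T2 := taylor (fun j => Derive_n u (S (S j)) m) m k).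
  assert (DT : forall x, is_derive T x (T1 x)) by (intros; apply is_derive_taylor).
  assert (DT1 : forall x, is_derive T1 x (T2 x))
    by (intros; apply (is_derive_taylor (fun j => Derive_n u (S j) m))).
  set (E := M * (r - l) ^ S (S k)).
  assert (B0 : forall x, l < x < r -> Rabs (u x - T x) <= E).
  { apply (taylor_remainder l r m M (S (S k)) (fun j => Derive_n u j)); try assumption.
    intros j y Hj Hy; apply HU; [lia | exact Hy]. }
  assert (B1 : forall x, l < x < r ->
            Rabs (Derive u x - T1 x) <= M * (r - l) ^ S k).
  { apply (taylor_remainder l r m M (S k) (fun j => Derive_n u (S j))); try assumption.
    intros j y Hj Hy; apply HU; [lia | exact Hy]. }
  assert (B2 : forall x, l < x < r ->
            Rabs (Derive_n u 2 x - T2 x) <= M * (r - l) ^ k).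
  { apply (taylor_remainder l r m M k (fun j => Derive_n u (S (S j)))); try assumption.
    intros j y Hj Hy; apply HU; [lia | exact Hy]. }
  assert (B0' : forall x, l <= x <= r -> Rabs (u x - T x) <= E).
  { intros x Hx. rewrite (Eu x Hx).
    apply (bound_closed_interval (fun x => uc x - T x) l r); auto.
    intros y; apply (continuous_minus uc T). auto.
    apply (ex_derive_continuous T). exists (T1 y); auto.
    intros y Hy. rewrite <- Eu by lra; auto. }
  set (A := u l - T l). set (s := ((u r - T r) - (u l - T l)) / (r - l)).
  assert (Bl : Rabs A <= E) by (apply B0'; lra).
  assert (Br : Rabs (u r - T r) <= E) by (apply B0'; lra).
  assert (Bs : Rabs (s * (r - l)) <= 2 * E).
  { unfold s, A in *. field_simplify (((u r - T r) - (u l - T l)) / (r - l) * (r - l)); try lra.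
    apply Rabs_le_between in Bl; apply Rabs_le_between in Br.
    apply Rabs_le; lra. }
  exists (fun x => T x + (A + s * (x - l))).
  split; [|split; [|split]].
  - apply polyfun_plus. apply polyfun_taylor.
    apply polyfun_le with 1%nat. lia. apply affine_polyfun.
  - unfold A; ring.
  - unfold A, s; field; lra.
  - intros x Hx.
    destruct (derivatives_add_affine T T1 T2 A l s x DT DT1) as [-> ->].
    split; [|split; auto].
    + replace (u x - (T x + (A + s * (x - l))))
        with ((u x - T x) - A - s * (x - l)) by ring.
      assert (Bx : Rabs (s * (x - l)) <= 2 * E).
      { apply Rle_trans with (2 := Bs). rewrite 2!Rabs_mult.
        apply Rmult_le_compat_l. apply Rabs_pos. rewrite 2!Rabs_right; lra. }
      specialize (B0 x Hx). replace (4 * M * (r - l) ^ S (S k)) with (4 * E) by (unfold E; ring).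
      apply Rabs_le_between in Bl; apply Rabs_le_between in B0;
      apply Rabs_le_between in Bx. apply Rabs_le; lra.
    + replace (Derive u x - (T1 x + s)) with ((Derive u x - T1 x) - s) by ring.
      assert (Bs' : Rabs s <= 2 * (M * (r - l) ^ S k)).
      { apply Rmult_le_reg_r with (r - l). lra.
        rewrite <- (Rabs_right (r - l)) at 1 by lra. rewrite <- Rabs_mult.
        apply Rle_trans with (1 := Bs). unfold E. simpl; right; ring. }
      specialize (B1 x Hx).
      apply Rabs_le_between in B1; apply Rabs_le_between in Bs'.
      apply Rabs_le; lra.
Qed.

(** The slope is available in two forms, as a difference quotient and as [u'] at an interior point;
    the weighted bound of [x] times the slope uses one or the other, depending on the position of
    [x]. *)
Lemma affine_interpolant (u uc : R -> R) (l r : R) :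
  l < r -> (forall x, continuous uc x) -> (forall x, l <= x <= r -> u x = uc x) ->
  (forall x, l < x < r -> is_derive u x (Derive u x)) ->
  exists p xi, polyfun 1 p /\ p l = u l /\ p r = u r /\ l < xi < r /\
    forall x, l < x < r ->
      p x = u l + Derive u xi * (x - l) /\
      Derive p x = Derive u xi /\ Derive_n p 2 x = 0 /\
      Derive u xi * (r - l) = u r - u l.
Proof.
  intros Hlr Huc Eu Du.
  destruct (MVT_open uc (Derive u) l r Hlr) as [xi [Hxi H]]; auto.
  { intros x Hx. apply (is_derive_ext_open l r) with u; auto.
    intros; apply Eu; lra. }
  rewrite <- !Eu in H by lra.
  (* The summand [0] lets [derivatives_add_affine] be reused with the zero function as [T]. *)
  exists (fun x => 0 + (u l + Derive u xi * (x - l))), xi.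
  split; [|split; [|split; [|split; [exact Hxi|]]]].
  - apply polyfun_plus. apply polyfun_const. apply affine_polyfun.
  - ring.
  - lra.
  - intros x Hx. destruct (derivatives_add_affine (fun _ => 0) (fun _ => 0)
      (fun _ => 0) (u l) l (Derive u xi) x) as [-> ->].
    1, 2: intros; apply (is_derive_const 0).
    repeat split; lra.
Qed.

(** * Sums over the mesh cells *)

Section SumCells.

Variable N : nat.
Hypothesis HN : (0 < N)%nat.

Lemma cell_index_of_nat (j : nat) :
  (j <= 2 * N - 1)%nat -> cell_index N (Z.of_nat j - Z.of_nat N + 1).
Proof. unfold cell_index; lia. Qed.

Lemma sum_cells_le (F G : Z -> R) :
  (forall i, cell_index N i -> F i <= G i) -> sum_cells N F <= sum_cells N G.
Proof.
  intros H. apply sum_Rle. intros j Hj. now apply H, cell_index_of_nat.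
Qed.

Lemma sum_cells_ext (F G : Z -> R) :
  (forall i, cell_index N i -> F i = G i) -> sum_cells N F = sum_cells N G.
Proof.
  intros H. apply sum_eq. intros j Hj. now apply H, cell_index_of_nat.
Qed.

Lemma sum_cells_plus (F G : Z -> R) :
  sum_cells N F + sum_cells N G = sum_cells N (fun i => F i + G i).
Proof. unfold sum_cells. now rewrite sum_plus. Qed.

Lemma sum_cells_scal (d : R) (F : Z -> R) :
  d * sum_cells N F = sum_cells N (fun i => d * F i).
Proof. unfold sum_cells. rewrite scal_sum. apply sum_eq; intros; apply Rmult_comm. Qed.

Lemma sum_cells_minus (F G : Z -> R) :
  sum_cells N F - sum_cells N G = sum_cells N (fun i => F i - G i).
Proof. unfold sum_cells. now rewrite minus_sum. Qed.

Lemma sum_cells_const (d : R) : sum_cells N (fun _ => d) = 2 * INR N * d.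
Proof.
  unfold sum_cells. rewrite sum_cte.
  replace (S (2 * N - 1)) with (2 * N)%nat by lia. rewrite mult_INR. simpl; ring.
Qed.

(** Boundary terms left by cellwise integration by parts have this form, so that only the values at
    -1 and 1 survive; cell lengths are another instance. *)
Lemma sum_cells_telescope (G : Z -> R) :
  sum_cells N (fun i => G i - G (i - 1)%Z)
  = G (Z.of_nat N) - G (- Z.of_nat N)%Z.
Proof.
  assert (H : forall n, sum_f_R0 (fun j : nat =>
    G (Z.of_nat j - Z.of_nat N + 1)%Z - G (Z.of_nat j - Z.of_nat N + 1 - 1)%Z) n
    = G (Z.of_nat n - Z.of_nat N + 1)%Z - G (- Z.of_nat N)%Z).
  { induction n.
    - simpl sum_f_R0. do 2 f_equal. lia.
    - rewrite tech5, IHn.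
      replace (Z.of_nat (S n) - Z.of_nat N + 1 - 1)%Z
        with (Z.of_nat n - Z.of_nat N + 1)%Z by lia. ring. }
  unfold sum_cells. rewrite H. do 2 f_equal. lia.
Qed.

Lemma sum_cells_RInt (X : Z -> R) (g : R -> R) :
  (forall i, cell_index N i -> ex_RInt g (X (i - 1)%Z) (X i)) ->
  RInt g (X (- Z.of_nat N)%Z) (X (Z.of_nat N))
  = sum_cells N (fun i => RInt g (X (i - 1)%Z) (X i)).
Proof.
  intros Hg.
  assert (H : forall n, (n <= 2 * N - 1)%nat ->
    is_RInt g (X (- Z.of_nat N)%Z) (X (Z.of_nat n - Z.of_nat N + 1)%Z)
      (sum_f_R0 (fun j : nat => RInt g (X (Z.of_nat j - Z.of_nat N + 1 - 1)%Z)
         (X (Z.of_nat j - Z.of_nat N + 1)%Z)) n)).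
  { induction n; intros Hn; [simpl sum_f_R0 | rewrite tech5].
    - specialize (Hg _ (cell_index_of_nat 0 Hn)).
      replace (- Z.of_nat N)%Z with (Z.of_nat 0 - Z.of_nat N + 1 - 1)%Z at 1 by lia.
      now apply (RInt_correct (V:=R_CompleteNormedModule)).
    - apply (is_RInt_Chasles g _ (X (Z.of_nat n - Z.of_nat N + 1)%Z)).
      apply IHn; lia.
      replace (Z.of_nat n - Z.of_nat N + 1)%Z
        with (Z.of_nat (S n) - Z.of_nat N + 1 - 1)%Z at 1 by lia.
      now apply (RInt_correct (V:=R_CompleteNormedModule)), Hg, cell_index_of_nat. }
  unfold sum_cells. rewrite <- (is_RInt_unique _ _ _ _ (H _ (le_n _))).
  do 2 f_equal. lia.
Qed.

End SumCells.

(** * Regularity of the solution *)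

Fixpoint differentiable (n : nat) (g : R -> R) : Prop :=
  match n with
  | O => True
  | S n' => (forall x, -1 < x < 1 -> ex_derive g x) /\ differentiable n' (Derive g)
  end.

Lemma differentiable_ext (n : nat) (g h : R -> R) :
  (forall x, -1 < x < 1 -> g x = h x) -> differentiable n g -> differentiable n h.
Proof.
  revert g h; induction n; simpl; auto. intros g h E [D Dn]; split.
  - intros x Hx. destruct (D x Hx) as [d Hd]. exists d.
    now apply (is_derive_ext_open (-1) 1) with g.
  - apply IHn with (2 := Dn). intros x Hx. apply Derive_ext_loc.
    now apply (locally_open (-1) 1).
Qed.

Lemma differentiable_le (n m : nat) (g : R -> R) :
  (n <= m)%nat -> differentiable m g -> differentiable n g.
Proof.
  revert m g; induction n; intros m g Hnm Hg. exact I.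
  destruct m. lia. simpl in *. split. apply Hg. apply IHn with m. lia. apply Hg.
Qed.

Lemma differentiable_plus (n : nat) (g h : R -> R) :
  differentiable n g -> differentiable n h -> differentiable n (fun x => g x + h x).
Proof.
  revert g h; induction n; simpl; auto. intros g h [D Dn] [E En]; split.
  - intros x Hx. apply (ex_derive_plus g h); auto.
  - apply differentiable_ext with (fun x => Derive g x + Derive h x); auto.
    intros x Hx. symmetry; apply Derive_plus; auto.
Qed.

(** Since [differentiable] recurses through [Derive g], one use of the product rule reduces the
    order by one for both resulting products; no Leibniz formula is involved. *)
Lemma differentiable_mult (n : nat) (g h : R -> R) :
  differentiable n g -> differentiable n h -> differentiable n (fun x => g x * h x).
Proof.
  revert g h; induction n. simpl; auto. intros g h Hg Hh; split.
  - intros x Hx. apply (ex_derive_mult g h). now apply Hg. now apply Hh.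
  - apply differentiable_ext with (fun x => Derive g x * h x + g x * Derive h x).
    + intros x Hx. symmetry; apply Derive_mult. now apply Hg. now apply Hh.
    + apply differentiable_plus; apply IHn.
      apply Hg. apply differentiable_le with (2 := Hh); lia.
      apply differentiable_le with (2 := Hg); lia. apply Hh.
Qed.

Lemma differentiable_const (n : nat) (d : R) : differentiable n (fun _ => d).
Proof.
  revert d; induction n; simpl; auto. intros d; split.
  - intros; apply ex_derive_const.
  - apply differentiable_ext with (fun _ => 0); auto.
    intros; symmetry; apply Derive_const.
Qed.

Lemma Derive_n_Derive (g : R -> R) (n : nat) (x : R) :
  Derive_n (Derive g) n x = Derive_n g (S n) x.
Proof.
  change (Derive g) with (Derive_n g 1). rewrite Derive_n_comp.
  now rewrite Nat.add_1_r.
Qed.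

Lemma differentiable_is_derive (n : nat) (g : R -> R) :
  differentiable n g ->
  forall j x, (j < n)%nat -> -1 < x < 1 ->
    is_derive (Derive_n g j) x (Derive_n g (S j) x).
Proof.
  intros Hg j x Hj Hx. apply Derive_correct.
  revert g j Hj Hg; induction n; intros g j Hj Hg. lia.
  destruct j. now apply Hg.
  apply ex_derive_ext with (Derive_n (Derive g) j).
  intros t; apply Derive_n_Derive. apply IHn. lia. apply Hg.
Qed.

Lemma class_C_differentiable (m : nat) (g : R -> R) :
  class_C m g -> differentiable m g.
Proof.
  intros Hg.
  (* The induction starts at the highest derivative and descends, because [differentiable] looks at
     [Derive g] while [class_C] speaks of [Derive_n g]. *)
  assert (H : forall n, (n <= m)%nat -> differentiable n (Derive_n g (m - n))).
  { induction n; intros Hn. exact I. split.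
    - intros x Hx. destruct (Hg (S (m - S n)) x) as [E _]; try lra; try lia.
      exact E.
    - change (Derive (Derive_n g (m - S n))) with (Derive_n g (S (m - S n))).
      replace (S (m - S n)) with (m - n)%nat by lia. apply IHn; lia. }
  specialize (H m (le_n m)). now rewrite Nat.sub_diag in H.
Qed.

Lemma class_C_continuous_I (j k : nat) (g : R -> R) :
  (j <= k)%nat -> class_C k g -> continuous_I (Derive_n g j).
Proof. intros Hj Hg. apply continuous_I_of_pt. intros; now apply Hg. Qed.

Section Solution.

Variables (eps : R) (a c f u : R -> R) (m : nat).
Hypothesis Heps : 0 < eps.
Hypotheses (Ha : class_C (S m) a) (Hc : class_C (S m) c) (Hf : class_C (S m) f).
Hypothesis Hu : bvp_solution eps a c f u.

Lemma solution_second_derivative (x : R) :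
  -1 < x < 1 ->
  Derive_n u 2 x = / eps * (a x * Derive u x + c x * u x + (-1) * f x).
Proof.
  intros Hx. destruct Hu as (_ & _ & _ & H).
  destruct (H x Hx) as (_ & _ & E).
  apply Rmult_eq_reg_l with eps; [|lra]. rewrite <- Rmult_assoc, Rinv_r by lra. lra.
Qed.

(** Bootstrapping: divided by [eps], the equation expresses [u''] through [u'], [u] and the data, so
    every order of differentiability already known yields the next one. *)
Lemma solution_differentiable : differentiable (S (S m)) u.
Proof.
  assert (U : forall n, (n <= S (S m))%nat -> differentiable n u).
  { assert (D : forall x, -1 < x < 1 -> ex_derive u x /\ ex_derive (Derive u) x).
    { intros x Hx. destruct Hu as (_ & _ & _ & H). split; now apply H. }
    induction n; intros Hn. exact I.
    specialize (IHn ltac:(lia)).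
    destruct n. split; simpl; auto; intros; now apply D.
    split. intros; now apply D.
    split. intros; now apply D.
    apply differentiable_ext with
      (fun x => / eps * (a x * Derive u x + c x * u x + (-1) * f x)).
    intros x Hx; symmetry; now apply solution_second_derivative.
    assert (n <= S m)%nat by lia.
    apply differentiable_mult. apply differentiable_const.
    apply differentiable_plus. apply differentiable_plus.
    apply differentiable_mult. apply differentiable_le with (S m); auto using class_C_differentiable.
    apply IHn.
    apply differentiable_mult. apply differentiable_le with (S m); auto using class_C_differentiable.
    apply differentiable_le with (2 := IHn); lia.
    apply differentiable_mult. apply differentiable_const.
    apply differentiable_le with (S m); auto using class_C_differentiable. }
  now apply U.
Qed.

(* Integrating the equation by parts expresses [eps * u'] through [u] alone,
   which is continuous up to the boundary; hence so is [u']. *)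
Lemma solution_C2_cell : C2_cell (-1) 1 u.
Proof.
  set (cl := fun (g : R -> R) y => g (clamp y)).
  assert (Cc : forall g, continuous_I g -> forall x, continuous (cl g) x)
    by (intros; now apply continuous_comp_clamp).
  assert (Ca : continuous_I a) by (apply (class_C_continuous_I 0 (S m)); auto; lia).
  assert (Ca' : continuous_I (Derive a)) by (apply (class_C_continuous_I 1 (S m)); auto; lia).
  assert (Cc' : continuous_I c) by (apply (class_C_continuous_I 0 (S m)); auto; lia).
  assert (Cf : continuous_I f) by (apply (class_C_continuous_I 0 (S m)); auto; lia).
  assert (Cu : continuous_I u) by apply Hu.
  assert (id : forall g x, -1 <= x <= 1 -> cl g x = g x).
  { intros g x Hx. unfold cl. now rewrite clamp_id. }
  (* From [(eps u' - a u)' = (c - a') u - f]. The constant in [p1] is chosen so that [p1] and [u']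
     agree at 0; having the same derivative, they agree on the open interval. *)
  set (q := fun y => (cl c y - cl (Derive a) y) * cl u y - cl f y).
  set (p1 := fun x => (Derive u 0 - / eps * (a 0 * u 0))
                 + / eps * (cl a x * cl u x + RInt q 0 x)).
  set (p2 := fun x => / eps * (cl a x * p1 x + cl c x * cl u x + (-1) * cl f x)).
  assert (Cq : forall x, continuous q x).
  { intros x. apply (continuous_minus (V:=R_NormedModule)); [|now apply Cc].
    apply (continuous_mult (K:=R_AbsRing)); [|now apply Cc].
    apply (continuous_minus (V:=R_NormedModule)); now apply Cc. }
  assert (C1 : forall x, continuous p1 x).
  { intros x. apply (continuous_plus (V:=R_NormedModule)). apply continuous_const.
    apply (continuous_mult (K:=R_AbsRing)). apply continuous_const.
    apply (continuous_plus (V:=R_NormedModule)).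
    apply (continuous_mult (K:=R_AbsRing)); now apply Cc.
    apply (ex_derive_continuous (fun x => RInt q 0 x)).
    exists (q x). now apply is_derive_RInt_continuous. }
  assert (Du : forall x, -1 < x < 1 -> is_derive u x (Derive u x) /\
                 is_derive (Derive u) x (Derive_n u 2 x)).
  { intros x Hx. destruct Hu as (_ & _ & _ & H). split; apply Derive_correct; now apply H. }
  assert (Dcl : forall g d x, -1 < x < 1 -> is_derive g x d -> is_derive (cl g) x d).
  { intros g d x Hx. apply (is_derive_ext_open (-1) 1); auto.
    intros; symmetry; apply id; lra. }
  assert (D1 : forall x, -1 < x < 1 -> is_derive p1 x (Derive_n u 2 x)).
  { intros x Hx. rewrite solution_second_derivative by auto.
    assert (Da : is_derive (cl a) x (Derive a x)).
    { apply Dcl; auto. apply Derive_correct. apply (Ha 1%nat x); lia || lra. }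
    assert (Du' : is_derive (cl u) x (Derive u x)) by (exact (Dcl u _ x Hx (proj1 (Du x Hx)))).
    assert (Dq : is_derive (fun x => RInt q 0 x) x (q x))
      by (now apply is_derive_RInt_continuous).
    evar_last.
    apply (is_derive_plus (fun _ : R => Derive u 0 - / eps * (a 0 * u 0))
      (fun x => / eps * (cl a x * cl u x + RInt q 0 x))).
    apply is_derive_const.
    apply (is_derive_scal (fun x => cl a x * cl u x + RInt q 0 x)).
    apply (is_derive_plus (fun x => cl a x * cl u x)). 2: exact Dq.
    apply (is_derive_mult (cl a) (cl u) x _ _ Da Du'). intros; apply Rmult_comm.
    unfold plus, mult, zero; simpl. unfold q. rewrite !id by lra. ring. }
  assert (E1 : forall x, -1 < x < 1 -> Derive u x = p1 x).
  { intros x Hx. apply Rminus_diag_uniq.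
    assert (E : Derive u x - p1 x = Derive u 0 - p1 0).
    { apply (constant_open (fun x => Derive u x - p1 x) (-1) 1); try lra.
      intros z Hz. replace 0 with (Derive_n u 2 z - Derive_n u 2 z) by ring.
      apply (is_derive_minus (Derive u) p1). now apply Du. now apply D1. }
    rewrite E. unfold p1. rewrite (RInt_point 0 q), !id by lra.
    change (zero : R) with 0. ring. }
  exists (cl u), p1, p2. split; [now apply Cc|]. split; [exact C1|]. split.
  { intros x. apply (continuous_mult (K:=R_AbsRing)). apply continuous_const.
    apply (continuous_plus (V:=R_NormedModule)). apply (continuous_plus (V:=R_NormedModule)).
    apply (continuous_mult (K:=R_AbsRing)); auto.
    apply (continuous_mult (K:=R_AbsRing)); auto.
    apply (continuous_mult (K:=R_AbsRing)); auto. apply continuous_const. }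
  split; [intros; now rewrite id|]. split.
  - intros x Hx. rewrite <- E1 by auto. exact (Dcl u _ x Hx (proj1 (Du x Hx))).
  - intros x Hx. replace (p2 x) with (Derive_n u 2 x). now apply D1.
    rewrite solution_second_derivative by auto. unfold p2.
    rewrite <- E1, !id by lra. reflexivity.
Qed.

End Solution.

Lemma C2_cell_sub (l r l' r' : R) (v : R -> R) :
  l <= l' -> r' <= r -> C2_cell l r v -> C2_cell l' r' v.
Proof.
  intros Hl Hr (p0 & p1 & p2 & C0 & C1 & C2 & E0 & E1 & E2).
  exists p0, p1, p2. do 3 (split; [assumption|]).
  split; [|split]; intros; [apply E0|apply E1|apply E2]; lra.
Qed.

Lemma exp_monotone (x y : R) : x <= y -> exp x <= exp y.
Proof. intros [L|L]. left; now apply exp_increasing. right; now rewrite L. Qed.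

(** * Geometry of the mesh *)

Section Mesh.

Variables K N : nat.
Hypotheses (HN : (0 < N)%nat) (HK : Nat.divide (K + 1) N).

Let M := Nat.div N (K + 1).
Let H := INR (K + 1) / INR N.
Let hm := half_mesh K N.

Lemma cells_per_subinterval : (0 < M)%nat /\ N = (M * (K + 1))%nat.
Proof.
  destruct HK as [z Hz]. unfold M.
  assert (Nat.div N (K + 1) = z) by (rewrite Hz; apply Nat.div_mul; lia).
  nia.
Qed.

(** Divisibility makes [H] exactly the length of a cell relative to its subinterval. The last bound
    later converts powers of [/ N] into powers of [H]. *)
Lemma mesh_ratio : H = / INR M /\ 0 < H <= 1 /\ / INR N <= H.
Proof.
  destruct cells_per_subinterval as [HM E].
  assert (PM : 1 <= INR M) by (apply (le_INR 1); lia).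
  assert (PK : 1 <= INR (K + 1)) by (apply (le_INR 1); lia).
  assert (HE : H = / INR M).
  { unfold H. rewrite E, mult_INR. field; lra. }
  split; [exact HE|]. rewrite HE. split; [split|].
  - apply Rinv_0_lt_compat; lra.
  - rewrite <- Rinv_1. apply Rinv_le_contravar; lra.
  - apply Rinv_le_contravar. lra. rewrite E, mult_INR. nra.
Qed.

(** Every subinterval but the first is of the form [(b, 10 b]]: this is the origin of the constants
    9 (its length over [b]) and 10 in the cell estimates. The first one starts at 0 and has no such
    ratio. *)
Lemma breakpoint_gap (j : nat) :
  (j <= K)%nat ->
  (j = 0%nat /\ breakpoint K 0 = 0 /\ breakpoint K 1 = / 10 ^ K) \/
  (0 < breakpoint K j /\ breakpoint K (S j) = 10 * breakpoint K j).
Proof.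
  intros Hj. destruct j as [|j].
  - left. simpl. rewrite Nat.sub_0_r. auto.
  - right. simpl breakpoint. replace (K - j)%nat with (S (K - S j)) by lia.
    assert (0 < 10 ^ (K - S j)) by (apply pow_lt; lra).
    simpl pow. split. apply Rinv_0_lt_compat; lra. field; lra.
Qed.

Lemma half_mesh_endpoints : hm 0 = 0 /\ hm N = 1.
Proof.
  destruct cells_per_subinterval as [HM E].
  unfold hm, half_mesh. fold M. split.
  - rewrite Nat.Div0.div_0_l, Nat.Div0.mod_0_l. simpl. unfold Rdiv. ring.
  - replace (Nat.div N M) with (S K)
      by (rewrite E, Nat.mul_comm, Nat.div_mul; lia).
    replace (Nat.modulo N M) with 0%nat
      by (rewrite E, Nat.mul_comm, Nat.Div0.mod_mul; lia).
    simpl. rewrite Nat.sub_diag. simpl. unfold Rdiv. rewrite Rinv_1. ring.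
Qed.

Lemma half_mesh_cell (n : nat) :
  (n < N)%nat ->
  exists j q, (j <= K)%nat /\ (q < M)%nat /\
    hm n = breakpoint K j + INR q / INR M * (breakpoint K (S j) - breakpoint K j) /\
    hm (S n) = breakpoint K j
      + INR (S q) / INR M * (breakpoint K (S j) - breakpoint K j).
Proof.
  intros Hn. destruct cells_per_subinterval as [HM E].
  exists (Nat.div n M), (Nat.modulo n M).
  assert (Hq : (Nat.modulo n M < M)%nat) by (apply Nat.mod_upper_bound; lia).
  assert (D := Nat.div_mod_eq n M).
  set (j := Nat.div n M) in *. set (q := Nat.modulo n M) in *.
  split. { nia. }
  split; [exact Hq|]. split; [reflexivity|].
  unfold hm, half_mesh. fold M.
  (* For the last cell of a subinterval the index [S n] already belongs to the next subinterval,
     with remainder 0; its point is the common breakpoint. *)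
  destruct (Nat.eq_dec (S q) M) as [e|ne].
  - assert (D1 : Nat.div (S n) M = S j).
    { symmetry; apply Nat.div_unique with 0%nat; lia. }
    assert (D2 : Nat.modulo (S n) M = 0%nat).
    { symmetry; apply Nat.mod_unique with (S j); lia. }
    rewrite D1, D2, e. simpl (INR 0). field. apply not_0_INR; lia.
  - assert (D1 : Nat.div (S n) M = j).
    { symmetry; apply Nat.div_unique with (S q); lia. }
    assert (D2 : Nat.modulo (S n) M = S q).
    { symmetry; apply Nat.mod_unique with j; lia. }
    now rewrite D1, D2.
Qed.

Lemma half_mesh_shape (n : nat) :
  (n < N)%nat ->
  0 <= hm n < hm (S n) /\
  (hm (S n) - hm n = H * / 10 ^ K /\ hm (S n) <= / 10 ^ K \/
   0 < hm n /\ hm (S n) - hm n <= 9 * H * hm n).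
Proof.
  intros Hn. destruct (half_mesh_cell n Hn) as (j & q & Hj & Hq & -> & ->).
  destruct cells_per_subinterval as [HM E].
  destruct mesh_ratio as (HE & _ & _). rewrite HE.
  assert (PM : 1 <= INR M) by (apply (le_INR 1); lia).
  assert (HS : INR (S q) <= INR M) by (apply le_INR; lia).
  rewrite S_INR in *. assert (Q := pos_INR q).
  assert (IM : 0 < / INR M) by (apply Rinv_0_lt_compat; lra).
  assert (A : 0 <= INR q / INR M) by (apply Rmult_le_pos; lra).
  assert (B : (INR q + 1) / INR M = INR q / INR M + / INR M) by (field; lra).
  assert (C : (INR q + 1) / INR M <= 1)
    by (apply Rmult_le_reg_r with (INR M); [lra | field_simplify; lra]).
  rewrite B in *.
  destruct (breakpoint_gap j Hj) as [(-> & -> & ->)|[P ->]].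
  - assert (0 < / 10 ^ K) by (apply Rinv_0_lt_compat, pow_lt; lra).
    split; [nra|]. left. nra.
  - set (b := breakpoint K j) in *.
    assert (0 <= INR q / INR M * b) by (apply Rmult_le_pos; lra).
    assert (0 <= / INR M * (INR q / INR M * b)) by (apply Rmult_le_pos; lra).
    assert (0 < / INR M * b) by (apply Rmult_lt_0_compat; lra).
    split; [lra|]. right. split; lra.
Qed.

Lemma half_mesh_le_1 (n : nat) : (n <= N)%nat -> hm n <= 1.
Proof.
  intros Hn. destruct half_mesh_endpoints as [_ <-].
  assert (G : forall d, (d <= N)%nat -> hm (N - d) <= hm N).
  { induction d; intros Hd. rewrite Nat.sub_0_r; lra.
    destruct (half_mesh_shape (N - S d)) as [[_ L] _]. lia.
    replace (S (N - S d)) with (N - d)%nat in L by lia.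
    specialize (IHd ltac:(lia)). lra. }
  replace n with (N - (N - n))%nat by lia. apply G; lia.
Qed.

Let X (i : Z) : R := IZR (Z.sgn i) * hm (Z.abs_nat i).

Lemma mesh_cell (i : Z) :
  cell_index N i ->
  exists n, (n < N)%nat /\
    (X (i - 1)%Z = hm n /\ X i = hm (S n) \/
     X (i - 1)%Z = - hm (S n) /\ X i = - hm n).
Proof.
  intros Hi. unfold cell_index in Hi. destruct half_mesh_endpoints as [H0 _].
  unfold X. destruct (Z_lt_le_dec 0 i) as [L|L].
  - exists (Z.to_nat (i - 1)). split. lia. left.
    replace (Z.abs_nat (i - 1)) with (Z.to_nat (i - 1)) by lia.
    replace (Z.abs_nat i) with (S (Z.to_nat (i - 1))) by lia.
    rewrite (Z.sgn_pos i) by lia. split; [|ring].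
    (* The left end of cell 1 is the point with index 0, where [Z.sgn] is 0 instead of 1; the
       formula survives because [hm 0 = 0]. *)
    destruct (Z.eq_dec i 1) as [->|ne].
    simpl. rewrite H0. ring. rewrite Z.sgn_pos by lia. ring.
  - exists (Z.abs_nat i). split. lia. right.
    replace (Z.abs_nat (i - 1)) with (S (Z.abs_nat i)) by lia.
    rewrite (Z.sgn_neg (i - 1)) by lia. split; [ring|].
    destruct (Z.eq_dec i 0) as [->|ne].
    simpl. rewrite H0. ring. rewrite Z.sgn_neg by lia. ring.
Qed.

Lemma mesh_endpoints : X (- Z.of_nat N)%Z = -1 /\ X (Z.of_nat N) = 1.
Proof.
  unfold X. destruct half_mesh_endpoints as [_ H1].
  rewrite Z.sgn_neg, Z.sgn_pos by lia.
  replace (Z.abs_nat (- Z.of_nat N)) with N by lia.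
  replace (Z.abs_nat (Z.of_nat N)) with N by lia. rewrite H1. lra.
Qed.

(** The dichotomy decides the local scale. Away from the innermost subintervals the distance [d] of
    the cell to 0 is comparable with every [|t|] in it: [H <= 1] turns the length bound [9 H d] into
    [|t| <= 10 d]. *)
Lemma mesh_cell_shape (i : Z) :
  cell_index N i ->
  -1 <= X (i - 1)%Z /\ X (i - 1)%Z < X i /\ X i <= 1 /\
  (X i - X (i - 1)%Z = H * / 10 ^ K /\
     (forall t, X (i - 1)%Z <= t <= X i -> Rabs t <= / 10 ^ K)
   \/ exists d, 0 < d /\ X i - X (i - 1)%Z <= 9 * H * d /\
        forall t, X (i - 1)%Z <= t <= X i -> d <= Rabs t <= 10 * d).
Proof.
  intros Hi. destruct (mesh_cell i Hi) as (n & Hn & E).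
  destruct (half_mesh_shape n Hn) as [L S].
  assert (B := half_mesh_le_1 (Datatypes.S n) Hn).
  destruct mesh_ratio as (_ & P & _).
  split; [destruct E as [[E1 E2]|[E1 E2]]; lra|].
  split; [destruct E as [[E1 E2]|[E1 E2]]; lra|].
  split; [destruct E as [[E1 E2]|[E1 E2]]; lra|].
  destruct S as [[S1 S2]|[S1 S2]].
  - left. destruct E as [[E1 E2]|[E1 E2]]; rewrite E1, E2; (split; [lra|]); intros t Ht;
      apply Rabs_le; lra.
  - right. exists (hm n). split; [exact S1|].
    destruct E as [[E1 E2]|[E1 E2]]; rewrite E1, E2; (split; [lra|]); intros t Ht.
    rewrite Rabs_right by lra. nra. rewrite Rabs_left by lra. nra.
Qed.

End Mesh.

(** * The number of subintervals, and the a priori bounds in scaled form *)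

Section MeshK.

Variables (k N : nat) (lambda eps : R).
Hypotheses (HN : (0 < N)%nat) (Heps : 0 < eps <= 1).
Hypotheses (Hl : 0 < lambda) (Hk : lambda < INR (k + 1)).

Let theta := (1 - lambda / INR (k + 1)) / 2.

(** The bound 1/2 gives [sqrt eps <= eps^theta], which qualifies [eps^theta] as a local scale;
    positivity keeps [sigma] at most 1. *)
Lemma theta_bounds : 0 < theta <= 1 / 2.
Proof.
  unfold theta. assert (P : 0 < lambda / INR (k + 1)).
  { apply Rdiv_lt_0_compat; lra. }
  assert (lambda / INR (k + 1) < 1).
  { apply Rmult_lt_reg_r with (INR (k + 1)). lra. unfold Rdiv.
    rewrite Rmult_assoc, Rinv_l; lra. }
  lra.
Qed.

Lemma ln_eps_le_0 : ln eps <= 0.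
Proof. rewrite <- ln_1. apply ln_le; lra. Qed.

Lemma INR_N_ge_1 : 1 <= INR N.
Proof. apply (le_INR 1); lia. Qed.

Lemma mesh_sigma_bounds :
  / INR N ^ (2 * k + 1) <= mesh_sigma k lambda eps N <= 1 /\
  0 < / INR N ^ (2 * k + 1).
Proof.
  assert (P := INR_N_ge_1). assert (1 <= INR N ^ (2 * k + 1)) by (apply pow_R1_Rle; lra).
  split; [split|].
  - apply Rmax_r.
  - apply Rmax_lub.
    + fold theta. unfold Rpower. rewrite <- exp_0.
      assert (Q := theta_bounds). assert (L := ln_eps_le_0).
      apply exp_monotone. nra.
    + rewrite <- Rinv_1. apply Rinv_le_contravar; lra.
  - apply Rinv_0_lt_compat; lra.
Qed.

(** The 1 inside the floor makes [K] at least [- log10 sigma], so the innermost breakpoint does not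
    exceed [sigma]. The cutoff [N^-(2k+1)] in [sigma] is what keeps [K] logarithmic in [N],
    uniformly in [eps]. *)
Lemma mesh_K_bounds :
  / 10 ^ mesh_K k lambda eps N <= mesh_sigma k lambda eps N /\
  INR (mesh_K k lambda eps N) <= 1 + INR (2 * k + 1) * ln (INR N) / ln 10.
Proof.
  destruct mesh_sigma_bounds as [[S1 S2] S0]. assert (P := INR_N_ge_1).
  unfold mesh_K. set (sigma := mesh_sigma k lambda eps N) in *.
  assert (L10 : 0 < ln 10) by (rewrite <- ln_1; apply ln_increasing; lra).
  assert (Ls : ln sigma <= 0) by (rewrite <- ln_1; apply ln_le; lra).
  set (y := 1 - ln sigma / ln 10).
  assert (E : y * ln 10 = ln 10 - ln sigma) by (unfold y; field; lra).
  destruct (base_Int_part y) as [B1 B2].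
  assert (Y1 : 1 <= y) by nra.
  assert (Zp : (0 <= Int_part y)%Z).
  { apply Z.lt_succ_r. apply lt_IZR. unfold Z.succ. rewrite plus_IZR. lra. }
  assert (EK : INR (Z.to_nat (Int_part y)) = IZR (Int_part y)).
  { rewrite INR_IZR_INZ, Z2Nat.id; auto. }
  split.
  - rewrite <- (exp_ln (10 ^ _)) by (apply pow_lt; lra).
    rewrite <- (exp_ln sigma) by lra. rewrite <- exp_Ropp.
    rewrite ln_pow by lra. rewrite EK.
    apply exp_monotone. nra.
  - rewrite EK. apply Rle_trans with (1 := B1). unfold y.
    assert (L : - (INR (2 * k + 1) * ln (INR N)) <= ln sigma).
    { rewrite <- ln_pow, <- ln_Rinv by (try apply pow_lt; lra).
      apply ln_le; lra. }
    assert (I10 : 0 < / ln 10) by (apply Rinv_0_lt_compat; lra).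
    unfold Rdiv. nra.
Qed.

End MeshK.
(** With [s = sqrt eps + |x| <= 2], the product [s^i * s^(lambda - i) = s^lambda] is bounded because
    [lambda > 0]. For the second bound [s >= sqrt eps] and [lambda < k + 1] give [s^(lambda - k - 1)
    <= eps^((lambda - k - 1)/2)], which [eps^((k + 1) theta)] cancels exactly: this explains the
    exponent in [sigma]. *)
Lemma a_priori_scaled (k : nat) (a c f : R -> R) (lambda : R) :
  0 < lambda -> lambda < INR (k + 1) -> a_priori_bounds a c f k lambda ->
  exists C, 0 < C /\
    forall eps u, 0 < eps <= 1 -> bvp_solution eps a c f u ->
    forall x, -1 < x < 1 ->
      (forall i, (i <= k + 1)%nat ->
         (sqrt eps + Rabs x) ^ i * Rabs (Derive_n u i x) <= C) /\
      Rpower eps ((1 - lambda / INR (k + 1)) / 2) ^ (k + 1)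
        * Rabs (Derive_n u (k + 1) x) <= C.
Proof.
  intros Hl Hk [C [HC HB]].
  set (P := 2 ^ (k + 1) + Rpower 2 lambda + 1).
  assert (P2 : 1 <= 2 ^ (k + 1)) by (apply pow_R1_Rle; lra).
  assert (P3 : 0 < Rpower 2 lambda) by apply exp_pos.
  exists (C * P). split. { apply Rmult_lt_0_compat; unfold P; lra. }
  intros eps u Heps Hu x Hx.
  assert (Se : 0 < sqrt eps <= 1).
  { split. apply sqrt_lt_R0; lra. rewrite <- sqrt_1. apply sqrt_le_1; lra. }
  assert (Sx : 0 <= Rabs x <= 1).
  { split. apply Rabs_pos. apply Rabs_le; lra. }
  set (s := sqrt eps + Rabs x).
  assert (Hs : 0 < s <= 2) by (unfold s; lra).
  assert (B : forall i, (i <= k + 1)%nat ->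
    Rabs (Derive_n u i x) <= C * (1 + Rpower s (lambda - INR i)))
    by (intros; now apply HB).
  split.
  - intros i Hi.
    assert (E : s ^ i * Rpower s (lambda - INR i) = Rpower s lambda).
    { rewrite <- Rpower_pow, <- Rpower_plus by lra. f_equal; ring. }
    assert (s ^ i <= 2 ^ (k + 1)).
    { apply Rle_trans with (2 ^ i). apply pow_incr; lra.
      apply Rle_pow. lra. lia. }
    assert (Rpower s lambda <= Rpower 2 lambda) by (apply Rle_Rpower_l; lra).
    assert (Pi : 0 < s ^ i) by (apply pow_lt; lra).
    apply Rle_trans with (s ^ i * (C * (1 + Rpower s (lambda - INR i)))).
    apply Rmult_le_compat_l; [lra | auto].
    replace (s ^ i * (C * (1 + Rpower s (lambda - INR i))))
      with (C * (s ^ i + s ^ i * Rpower s (lambda - INR i))) by ring.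
    rewrite E. apply Rmult_le_compat_l; unfold P; lra.
  - set (theta := (1 - lambda / INR (k + 1)) / 2).
    set (t := Rpower eps theta ^ (k + 1)).
    assert (Lt : t = exp (INR (k + 1) * (theta * ln eps))).
    { unfold t. rewrite <- Rpower_pow by apply exp_pos.
      unfold Rpower at 1. unfold Rpower. now rewrite ln_exp. }
    assert (Et : INR (k + 1) * theta = (INR (k + 1) - lambda) / 2)
      by (unfold theta; field; lra).
    assert (Le : ln eps <= 0) by (rewrite <- ln_1; apply ln_le; lra).
    assert (Ls : ln eps / 2 <= ln s).
    { replace (ln eps / 2) with (ln (sqrt eps)).
      apply ln_le; unfold s; lra.
      rewrite <- Rpower_sqrt by lra. unfold Rpower. rewrite ln_exp. field. }
    assert (T1 : 0 < t <= 1).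
    { rewrite Lt. split. apply exp_pos. rewrite <- exp_0. apply exp_monotone. nra. }
    assert (T2 : t * Rpower s (lambda - INR (k + 1)) <= 1).
    { rewrite Lt. unfold Rpower. rewrite <- exp_plus, <- exp_0. apply exp_monotone. nra. }
    specialize (B (k + 1)%nat (le_n _)).
    apply Rle_trans with (t * (C * (1 + Rpower s (lambda - INR (k + 1))))).
    apply Rmult_le_compat_l; lra.
    replace (t * (C * (1 + Rpower s (lambda - INR (k + 1)))))
      with (C * (t + t * Rpower s (lambda - INR (k + 1)))) by ring.
    apply Rmult_le_compat_l; unfold P; lra.
Qed.

(** * Pointwise interpolation error on one cell *)

Definition interpolation_error (eps d : R) (u p : R -> R) (x : R) : R :=
  eps * (Derive u x - Derive p x) ^ 2 + (x * (Derive u x - Derive p x)) ^ 2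
  + (u x - p x) ^ 2 + d * (eps * (Derive_n u 2 x - Derive_n p 2 x)) ^ 2.

Lemma sqr_le (x y : R) : Rabs x <= y -> x ^ 2 <= y ^ 2.
Proof. intros L. rewrite <- (pow2_abs x). apply pow_incr. split; auto. apply Rabs_pos. Qed.

Section CellInterpolant.

Variables (k : nat) (eps d D C l r : R) (u uc : R -> R).
Hypotheses (Heps : 0 < eps <= 1) (HC : 0 < C) (HD : 0 <= D).
Hypotheses (Hlr : l < r) (Huc : forall x, continuous uc x).
Hypothesis Eu : forall x, l <= x <= r -> u x = uc x.
Hypothesis HU : forall j x, (j <= S k)%nat -> l < x < r ->
     is_derive (Derive_n u j) x (Derive_n u (S j) x).

(* [tau] is the distance of the cell to 0, regularised by [sqrt eps] or [sigma]. *)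
Lemma taylor_cell_error (H tau : R) :
  0 < H <= 1 -> 0 < tau -> sqrt eps <= tau -> r - l <= 9 * H * tau ->
  (forall x, l < x < r -> Rabs x <= 10 * tau) ->
  (forall x, l < x < r -> tau ^ S (S k) * Rabs (Derive_n u (S (S k)) x) <= C) ->
  0 <= d -> d * eps <= D * (r - l) ^ 2 ->
  exists p, polyfun (S k) p /\ p l = u l /\ p r = u r /\
    forall x, l < x < r ->
      interpolation_error eps d u p x
        <= (2205 + D) * (C * 9 ^ S k) ^ 2 * (H ^ S k) ^ 2.
Proof.
  intros HH Ht Hst Hh Hx HM Hd0 Hd.
  assert (T : 0 < tau ^ S (S k)) by (apply pow_lt; auto).
  destruct (taylor_interpolant k u uc l r (C / tau ^ S (S k)))
    as (p & Pp & Pl & Pr & B); auto.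
  { intros x Hxx. apply Rmult_le_reg_l with (tau ^ S (S k)); auto.
    replace (tau ^ S (S k) * (C / tau ^ S (S k))) with C by (field; lra). auto. }
  exists p. split; [exact Pp|]. split; [exact Pl|]. split; [exact Pr|].
  intros x Hxx. destruct (B x Hxx) as (B0 & B1 & B2). specialize (Hx x Hxx).
  set (h := r - l) in *. assert (Ph : 0 < h) by (unfold h; lra).
  set (z := h / tau). assert (Hz : 0 < z <= 9 * H).
  { unfold z. split. apply Rdiv_lt_0_compat; lra.
    apply Rmult_le_reg_r with tau; auto. unfold Rdiv.
    rewrite Rmult_assoc, Rinv_l; lra. }
  (* [W] is the common size of all contributions: the derivative error [m] satisfies [m * tau = W],
     with the factor [tau] taken from [sqrt eps] or from [x]. *)
  set (W := C * z ^ S k).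
  assert (PW : 0 < W) by (apply Rmult_lt_0_compat; auto; apply pow_lt; lra).
  assert (HW : W <= C * 9 ^ S k * H ^ S k).
  { unfold W. rewrite Rmult_assoc. apply Rmult_le_compat_l. lra.
    rewrite <- Rpow_mult_distr. apply pow_incr; lra. }
  assert (Eh : h = z * tau) by (unfold z; field; lra).
  assert (Tk : 0 < tau ^ k) by (apply pow_lt; auto).
  assert (E0 : C / tau ^ S (S k) * h ^ S (S k) = W * z).
  { unfold W. rewrite Eh, Rpow_mult_distr. simpl. field. lra. }
  assert (E1 : C / tau ^ S (S k) * h ^ S k * tau = W).
  { unfold W. rewrite Eh, Rpow_mult_distr. simpl. field. lra. }
  assert (E2 : C / tau ^ S (S k) * h ^ k * h = C / tau ^ S (S k) * h ^ S k)
    by (simpl; ring).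
  assert (M0 : 0 < C / tau ^ S (S k) * h ^ S k).
  { apply Rmult_lt_0_compat. apply Rdiv_lt_0_compat; auto. now apply pow_lt. }
  set (m := C / tau ^ S (S k) * h ^ S k) in *.
  set (m2 := C / tau ^ S (S k) * h ^ k) in *.
  assert (A0 : (u x - p x) ^ 2 <= (36 * W) ^ 2).
  { apply sqr_le. apply Rle_trans with (1 := B0).
    replace (4 * (C / tau ^ S (S k)) * h ^ S (S k)) with (4 * (W * z)) by (rewrite <- E0; ring).
    nra. }
  assert (B1' : (Derive u x - Derive p x) ^ 2 <= (3 * m) ^ 2).
  { apply sqr_le. apply Rle_trans with (1 := B1). unfold m; right; ring. }
  assert (Se : eps <= tau ^ 2).
  { rewrite <- (sqrt_sqrt eps) by lra. assert (P := sqrt_pos eps). nra. }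
  assert (Sx : x ^ 2 <= (10 * tau) ^ 2) by (apply sqr_le; auto).
  assert (A1 : eps * (Derive u x - Derive p x) ^ 2 <= 9 * W ^ 2).
  { apply Rle_trans with (tau ^ 2 * (3 * m) ^ 2).
    apply Rmult_le_compat; auto. lra. apply pow2_ge_0.
    rewrite <- E1. right; ring. }
  assert (A2 : (x * (Derive u x - Derive p x)) ^ 2 <= 900 * W ^ 2).
  { rewrite Rpow_mult_distr. apply Rle_trans with ((10 * tau) ^ 2 * (3 * m) ^ 2).
    apply Rmult_le_compat; auto. apply pow2_ge_0. apply pow2_ge_0.
    rewrite <- E1. right; ring. }
  (* The error of [u''] has one power of [h] less than that of [u']; [d * eps <= D * h ^ 2] restores
     it after squaring, and the remaining [eps] gives [tau ^ 2]. *)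
  assert (A3 : d * (eps * (Derive_n u 2 x - Derive_n p 2 x)) ^ 2 <= D * W ^ 2).
  { replace (d * (eps * (Derive_n u 2 x - Derive_n p 2 x)) ^ 2)
      with ((d * eps) * (eps * (Derive_n u 2 x - Derive_n p 2 x) ^ 2)) by ring.
    apply Rle_trans with ((D * h ^ 2) * (tau ^ 2 * m2 ^ 2)).
    apply Rmult_le_compat; auto. nra.
    apply Rmult_le_pos; [lra | apply pow2_ge_0].
    apply Rmult_le_compat; auto. lra. apply pow2_ge_0. now apply sqr_le.
    rewrite <- E1, <- E2. right; ring. }
  unfold interpolation_error.
  (* 2205 = 36^2 + 9 + 900, where 36 = 4 * 9 comes from [z <= 9]. *)
  apply Rle_trans with ((2205 + D) * W ^ 2). lra.
  rewrite Rmult_assoc, <- Rpow_mult_distr. apply Rmult_le_compat_l. lra.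
  apply pow_incr; lra.
Qed.

(** No smallness is gained, only boundedness: the weights in [interpolation_error] are dominated by
    the powers of [sqrt eps + |x|] in the a priori bounds of orders 0, 1 and 2. The one delicate
    term is [x] times the slope, since the slope is [u'] at another point. *)
Lemma affine_cell_error :
  (forall x, l < x < r -> forall i, (i <= 2)%nat ->
     (sqrt eps + Rabs x) ^ i * Rabs (Derive_n u i x) <= C) ->
  0 <= d <= D ->
  exists p, polyfun 1 p /\ p l = u l /\ p r = u r /\
    forall x, l < x < r ->
      interpolation_error eps d u p x <= (45 + D) * C ^ 2.
Proof.
  intros HB Hd.
  destruct (affine_interpolant u uc l r) as (p & xi & Pp & Pl & Pr & Hxi & B); auto.
  { intros x Hx. apply (HU 0%nat x); auto; lia. }
  exists p. split; [exact Pp|]. split; [exact Pl|]. split; [exact Pr|].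
  intros x Hx. destruct (B x Hx) as (Ex & E1 & E2 & Es).
  assert (Pe : 0 < sqrt eps) by (apply sqrt_lt_R0; lra).
  assert (U0 : forall y, l <= y <= r -> Rabs (u y) <= C).
  { intros y Hy. rewrite Eu by auto. apply (bound_closed_interval uc l r); auto.
    intros z Hz. rewrite <- Eu by lra. specialize (HB z Hz 0%nat ltac:(lia)).
    simpl in HB. lra. }
  assert (U1 : forall y, l < y < r ->
    sqrt eps * Rabs (Derive u y) <= C /\ Rabs y * Rabs (Derive u y) <= C).
  { intros y Hy. specialize (HB y Hy 1%nat ltac:(lia)).
    change (Derive_n u 1 y) with (Derive u y) in HB.
    assert (Py := Rabs_pos y). assert (Pd := Rabs_pos (Derive u y)). simpl in HB. nra. }
  assert (U2 : eps * Rabs (Derive_n u 2 x) <= C).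
  { specialize (HB x Hx 2%nat ltac:(lia)).
    apply Rle_trans with (2 := HB). apply Rmult_le_compat_r. apply Rabs_pos.
    rewrite <- (sqrt_sqrt eps) at 1 by lra. assert (Py := Rabs_pos x). nra. }
  assert (Ul := U0 l ltac:(lra)). assert (Ur := U0 r ltac:(lra)).
  assert (Ux := U0 x ltac:(lra)).
  destruct (U1 x Hx) as [V1 V2]. destruct (U1 xi Hxi) as [V3 V4].
  set (s := Derive u xi) in *.
  assert (S1 : Rabs (s * (r - l)) <= 2 * C).
  { rewrite Es. apply Rabs_le_between in Ul, Ur. apply Rabs_le; lra. }
  assert (A0 : (u x - p x) ^ 2 <= (4 * C) ^ 2).
  { apply sqr_le. rewrite Ex.
    assert (S2 : Rabs (s * (x - l)) <= 2 * C).
    { apply Rle_trans with (2 := S1). rewrite 2!Rabs_mult.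
      apply Rmult_le_compat_l. apply Rabs_pos. rewrite 2!Rabs_right; lra. }
    apply Rabs_le_between in Ul, S2, Ux. apply Rabs_le; lra. }
  rewrite Rabs_mult, (Rabs_right (r - l)) in S1 by lra.
  assert (S3 : Rabs x * Rabs s <= 4 * C).
  { assert (Ps := Rabs_pos s).
    (* Near 0 compared with the cell length, the difference quotient bounds the slope; otherwise
       [|xi|] is at least half of [|x|], and the weighted bound at [xi] serves. *)
    destruct (Rle_dec (Rabs x) (2 * (r - l))) as [L|L].
    - nra.
    - assert (Rabs x <= 2 * Rabs xi).
      { assert (Rabs x <= Rabs xi + (r - l)).
        { replace x with (xi + (x - xi)) at 1 by ring.
          apply Rle_trans with (1 := Rabs_triang _ _). apply Rplus_le_compat_l.
          apply Rabs_le; lra. }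
        lra. }
      nra. }
  assert (T : Rabs (Derive u x - s) <= Rabs (Derive u x) + Rabs s).
  { unfold Rminus. rewrite <- (Rabs_Ropp s). apply Rabs_triang. }
  assert (A1 : eps * (Derive u x - s) ^ 2 <= (2 * C) ^ 2).
  { rewrite <- (pow2_sqrt eps) at 1 by lra. rewrite <- Rpow_mult_distr.
    apply sqr_le. rewrite Rabs_mult, (Rabs_right (sqrt eps)) by lra. nra. }
  assert (A2 : (x * (Derive u x - s)) ^ 2 <= (5 * C) ^ 2).
  { apply sqr_le. rewrite Rabs_mult. assert (Px := Rabs_pos x). nra. }
  assert (A3 : d * (eps * (Derive_n u 2 x - 0)) ^ 2 <= D * C ^ 2).
  { apply Rmult_le_compat; try lra. apply pow2_ge_0. apply sqr_le.
    rewrite Rminus_0_r, Rabs_mult, (Rabs_right eps) by lra. auto. }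
  (* 45 = 2^2 + 5^2 + 4^2. *)
  unfold interpolation_error. rewrite E1, E2. lra.
Qed.

End CellInterpolant.

(** * Integration over one cell, and gluing of local pieces *)

Lemma RInt_constant (l r d : R) : RInt (fun _ => d) l r = (r - l) * d.
Proof. exact (RInt_const (V:=R_CompleteNormedModule) l r d). Qed.

Lemma RInt_plus_extends (l r : R) (v w : R -> R) :
  l <= r -> extends l r v -> extends l r w ->
  RInt (fun x => v x + w x) l r = RInt v l r + RInt w l r.
Proof.
  intros Hlr Hv Hw. apply (RInt_plus (V:=R_CompleteNormedModule));
    now apply extends_ex_RInt.
Qed.

Lemma RInt_minus_extends (l r : R) (v w : R -> R) :
  l <= r -> extends l r v -> extends l r w ->
  RInt (fun x => v x - w x) l r = RInt v l r - RInt w l r.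
Proof.
  intros Hlr Hv Hw. apply (RInt_minus (V:=R_CompleteNormedModule));
    now apply extends_ex_RInt.
Qed.

Lemma RInt_scal_extends (l r d : R) (v : R -> R) :
  l <= r -> extends l r v -> RInt (fun x => d * v x) l r = d * RInt v l r.
Proof.
  intros Hlr Hv. apply (RInt_scal (V:=R_CompleteNormedModule)).
  now apply extends_ex_RInt.
Qed.

Lemma RInt_ext_open (l r : R) (v w : R -> R) :
  l <= r -> (forall x, l < x < r -> v x = w x) -> RInt v l r = RInt w l r.
Proof.
  intros Hlr E. apply RInt_ext. now rewrite Rmin_left, Rmax_right by lra.
Qed.

Lemma RInt_le_extends (l r : R) (v w : R -> R) :
  l <= r -> extends l r v -> extends l r w ->
  (forall x, l < x < r -> v x <= w x) -> RInt v l r <= RInt w l r.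
Proof.
  intros Hlr Hv Hw L. apply RInt_le; auto; now apply extends_ex_RInt.
Qed.

Ltac extends_tac :=
  first [ assumption | lazymatch goal with
  | |- extends _ _ (fun x => @?f x + @?g x) => apply (extends_plus _ _ f g); extends_tac
  | |- extends _ _ (fun x => @?f x - @?g x) => apply (extends_minus _ _ f g); extends_tac
  | |- extends _ _ (fun x => @?f x * @?g x) => apply (extends_mult _ _ f g); extends_tac
  | |- extends _ _ (fun x => @?f x ^ 2) => apply (extends_sqr _ _ f); extends_tac
  | |- extends _ _ (fun x => x) => apply extends_id
  | |- _ => apply extends_const
  end ].

Lemma norm_L2_sqr (l r : R) (v : R -> R) :
  l <= r -> extends l r v -> norm_L2 l r v ^ 2 = RInt (fun x => v x ^ 2) l r.
Proof.
  intros Hlr Hv. unfold norm_L2. apply pow2_sqrt.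
  apply RInt_ge_0; auto.
  apply extends_ex_RInt; auto. extends_tac.
  intros; apply pow2_ge_0.
Qed.

Lemma RInt_product (l r : R) (P P' v : R -> R) :
  l < r -> (forall x, continuous P x) ->
  (forall x, l < x < r -> is_derive P x (P' x)) ->
  extends l r P' -> C2_cell l r v ->
  RInt (fun x => P' x * v x + P x * Derive v x) l r = P r * v r - P l * v l.
Proof.
  intros Hlr HP DP EP Hv.
  destruct (C2_cell_regular l r v Hv) as (V0 & V1 & _ & Dv).
  destruct Hv as (p0 & _ & _ & C0 & _ & _ & E0 & _).
  assert (EP0 : extends l r P) by (exists P; auto).
  assert (EX : extends l r (fun x => P' x * v x + P x * Derive v x)) by extends_tac.
  destruct EX as [G [CG EG]].
  rewrite (FTC_open (fun x => P x * p0 x) _ G); auto.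
  - now rewrite !E0 by lra.
  - intros x Hx. now apply (continuous_mult P p0).
  - intros x Hx. apply (is_derive_ext_open l r x _ (fun x => P x * v x)); auto.
    intros y Hy. rewrite E0; lra.
    apply (is_derive_mult P v x _ _ (DP x Hx) (proj1 (Dv x Hx))).
    intros; apply Rmult_comm.
Qed.

Lemma RInt_combination (l r d1 d2 d3 d4 : R) (v1 v2 v3 v4 : R -> R) :
  l <= r -> extends l r v1 -> extends l r v2 -> extends l r v3 -> extends l r v4 ->
  RInt (fun x => d1 * v1 x + (d2 * v2 x - d3 * v3 x) + d4 * v4 x) l r
  = d1 * RInt v1 l r + (d2 * RInt v2 l r - d3 * RInt v3 l r) + d4 * RInt v4 l r.
Proof.
  intros Hlr H1 H2 H3 H4.
  rewrite (RInt_plus_extends l r (fun x => d1 * v1 x + (d2 * v2 x - d3 * v3 x))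
    (fun x => d4 * v4 x)) by (extends_tac || lra).
  rewrite (RInt_plus_extends l r (fun x => d1 * v1 x)
    (fun x => d2 * v2 x - d3 * v3 x)) by (extends_tac || lra).
  rewrite (RInt_minus_extends l r (fun x => d2 * v2 x) (fun x => d3 * v3 x))
    by (extends_tac || lra).
  now rewrite !RInt_scal_extends by auto.
Qed.

Lemma glue (Y : nat -> R) (u : R -> R) (P : nat -> (R -> R) -> Prop) (n : nat) :
  (forall j, (j < n)%nat -> Y j < Y (S j)) ->
  (forall j, (j < n)%nat -> exists p, (forall x, continuous p x) /\
     p (Y j) = u (Y j) /\ p (Y (S j)) = u (Y (S j)) /\ P j p) ->
  exists v, (forall x, continuous v x) /\ v (Y 0%nat) = u (Y 0%nat) /\
    v (Y n) = u (Y n) /\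
    forall j, (j < n)%nat ->
      exists p, P j p /\ forall x, Y j <= x <= Y (S j) -> v x = p x.
Proof.
  induction n; intros HY HP.
  - exists (fun _ => u (Y 0%nat)). split. intros; apply continuous_const.
    repeat split. intros; lia.
  - destruct IHn as (v & Cv & v0 & vn & Hv); [auto|auto|].
    destruct (HP n (le_n _)) as (p & Cp & p0 & p1 & Pp).
    assert (Mono : forall j, (j <= n)%nat -> Y j <= Y n).
    { intros j Hj. assert (G : forall d, (d <= n)%nat -> Y (n - d)%nat <= Y n).
      { induction d; intros Hd. rewrite Nat.sub_0_r; lra.
        assert (L := HY (n - S d)%nat ltac:(lia)).
        replace (S (n - S d)) with (n - d)%nat in L by lia.
        specialize (IHd ltac:(lia)). lra. }
      replace j with (n - (n - j))%nat by lia. apply G; lia. }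
    assert (Yn := HY n (le_n _)).
    (* To the left of [Y n] the bracket vanishes, to the right the first term is frozen at
       [u (Y n)]; one formula gives continuity at the joint without a separate argument. *)
    set (w := fun x => v (Rmin x (Y n)) + (p (Rmax x (Y n)) - u (Y n))).
    assert (wl : forall x, x <= Y n -> w x = v x).
    { intros x Hx. unfold w. rewrite Rmin_left, Rmax_right, p0 by lra. ring. }
    assert (wr : forall x, Y n <= x -> w x = p x).
    { intros x Hx. unfold w. rewrite Rmin_right, Rmax_left, vn by lra. ring. }
    exists w. split; [|split; [|split]].
    + intros x. apply (continuous_plus (V:=R_NormedModule)).
      apply (continuous_comp (fun x => Rmin x (Y n)) v); auto using continuous_Rmin_l.
      apply (continuous_minus (V:=R_NormedModule)).
      apply (continuous_comp (fun x => Rmax x (Y n)) p); auto using continuous_Rmax_l.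
      apply continuous_const.
    + rewrite wl; auto. apply Mono; lia.
    + rewrite wr; auto; lra.
    + intros j Hj. destruct (Nat.eq_dec j n) as [->|ne].
      * exists p. split; auto. intros; apply wr; lra.
      * destruct (Hv j) as (q & Pq & Eq). lia.
        exists q; split; auto. intros x Hx. rewrite wl; auto.
        apply Rle_trans with (1 := proj2 Hx). apply Mono; lia.
Qed.

(** The [e]'s are the values of [u - uI] and its derivatives at a point, the [z]'s those of
    [w = uI - uN]; the left side is minus the integrand of the form at the pair. The weights charge
    only a quarter of the coercive density to [w], half of what coercivity provides. *)
Lemma young_split (eps gamma D Mc A c d e0 e1 e2 z0 z1 : R) :
  0 < eps -> 0 < gamma -> 0 <= d <= D -> c ^ 2 <= Mc ^ 2 ->
  - (eps * e1 * z1 + A * e1 * z0 + c * e0 * z0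
     + d * ((- eps * e2 + A * e1 + c * e0) * (A * z1)))
  <= / 4 * (eps * z1 ^ 2 + gamma * z0 ^ 2 + d * (A * z1) ^ 2)
     + (4 + 2 / gamma + 2 * Mc ^ 2 / gamma + 3 * D + 3 * D * Mc ^ 2)
       * (eps * e1 ^ 2 + (A * e1) ^ 2 + e0 ^ 2 + d * (eps * e2) ^ 2).
Proof.
  intros Heps Hg Hd Hc.
  set (B := A * e1). set (W := A * z1). set (F := eps * e2).
  (* Two terms are paired with [z0] and three with [W], so the shares [gamma / 8] and [1 / 12] each
     add up to a quarter. *)
  assert (S : forall x y, - (y * x) <= gamma / 8 * x ^ 2 + 2 / gamma * y ^ 2).
  { intros x y. assert (0 <= gamma / 8 * (x + 4 / gamma * y) ^ 2).
    { apply Rmult_le_pos. lra. apply pow2_ge_0. }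
    replace (gamma / 8 * (x + 4 / gamma * y) ^ 2)
      with (gamma / 8 * x ^ 2 + y * x + 2 / gamma * y ^ 2) in H by (field; lra). lra. }
  assert (T : forall y, - (d * (y * W)) <= d * (W ^ 2 / 12 + 3 * y ^ 2)).
  { intros y. assert (0 <= d * (W / 2 + 3 * y) ^ 2).
    { apply Rmult_le_pos. lra. apply pow2_ge_0. }
    lra. }
  assert (G : 0 < 2 / gamma) by (apply Rdiv_lt_0_compat; lra).
  assert (I1 : 0 <= eps * (z1 / 2 + e1) ^ 2) by (apply Rmult_le_pos; [lra | apply pow2_ge_0]).
  assert (I2 := S z0 B). assert (I3 := S z0 (c * e0)).
  assert (I4 := T (- F)). assert (I5 := T B). assert (I6 := T (c * e0)).
  assert (PB := pow2_ge_0 B). assert (P0 := pow2_ge_0 e0). assert (P1 := pow2_ge_0 e1).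
  assert (PF := pow2_ge_0 F). assert (PM := pow2_ge_0 Mc).
  assert (Pe : 0 <= eps * e1 ^ 2) by (apply Rmult_le_pos; lra).
  assert (Pf : 0 <= d * F ^ 2) by (apply Rmult_le_pos; lra).
  assert (C0 : (c * e0) ^ 2 <= Mc ^ 2 * e0 ^ 2)
    by (rewrite Rpow_mult_distr; apply Rmult_le_compat_r; lra).
  assert (C1 : 2 / gamma * (c * e0) ^ 2 <= 2 * Mc ^ 2 / gamma * e0 ^ 2).
  { replace (2 * Mc ^ 2 / gamma * e0 ^ 2) with (2 / gamma * (Mc ^ 2 * e0 ^ 2)) by (field; lra).
    apply Rmult_le_compat_l; lra. }
  assert (C2 : d * (c * e0) ^ 2 <= D * Mc ^ 2 * e0 ^ 2).
  { rewrite Rmult_assoc. apply Rmult_le_compat; try lra. apply pow2_ge_0. }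
  assert (C3 : d * B ^ 2 <= D * B ^ 2) by (apply Rmult_le_compat_r; lra).
  set (K1 := 2 / gamma) in *. set (K2 := 2 * Mc ^ 2 / gamma) in *.
  assert (PK2 : 0 <= K2).
  { unfold K2, Rdiv. apply Rmult_le_pos. lra. left; apply Rinv_0_lt_compat; lra. }
  assert (PD : 0 <= D * Mc ^ 2) by (apply Rmult_le_pos; lra).
  set (E := eps * e1 ^ 2 + B ^ 2 + e0 ^ 2 + d * F ^ 2).
  assert (J1 : K1 * B ^ 2 <= K1 * E) by (apply Rmult_le_compat_l; unfold E; lra).
  assert (J2 : K2 * e0 ^ 2 <= K2 * E) by (apply Rmult_le_compat_l; unfold E; lra).
  assert (J3 : 3 * (D * B ^ 2) <= 3 * (D * E))
    by (apply Rmult_le_compat_l; [lra | apply Rmult_le_compat_l; unfold E; lra]).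
  assert (J4 : D * Mc ^ 2 * e0 ^ 2 <= D * Mc ^ 2 * E)
    by (apply Rmult_le_compat_l; unfold E; lra).
  apply Rle_trans with
    (/ 4 * (eps * z1 ^ 2 + gamma * z0 ^ 2 + d * W ^ 2)
     + (eps * e1 ^ 2 + K1 * B ^ 2 + K2 * e0 ^ 2 + 3 * (d * F ^ 2)
        + 3 * (D * B ^ 2) + 3 * (D * Mc ^ 2 * e0 ^ 2))).
  - replace (eps * e1 * z1 + B * z0 + c * e0 * z0 + d * ((- eps * e2 + B + c * e0) * W))
      with (eps * (e1 * z1) + B * z0 + c * e0 * z0 + d * (- F * W) + d * (B * W)
            + d * ((c * e0) * W)) by (unfold F; ring).
    replace ((- F) ^ 2) with (F ^ 2) in I4 by ring.
    lra.
  - unfold E in *. lra.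
Qed.

(** * Consistency, coercivity and the energy estimate on an abstract mesh *)

Section Energy.

Variables (eps gamma D Mc : R) (a c : R -> R) (k N : nat) (X delta : Z -> R).
Hypotheses (Heps : 0 < eps) (Hgamma : 0 < gamma) (HN : (0 < N)%nat).
Hypothesis HX : forall i, cell_index N i ->
  -1 <= X (i - 1)%Z /\ X (i - 1)%Z < X i /\ X i <= 1.
Hypotheses (X_left : X (- Z.of_nat N)%Z = -1) (X_right : X (Z.of_nat N) = 1).
Hypothesis Hdelta : forall i, cell_index N i -> 0 <= delta i <= D.
Hypotheses (Ca : class_C 1 a) (Cc : continuous_I c).
Hypothesis HMc : forall x, -1 < x < 1 -> Rabs (c x) <= Mc.

Definition piecewise_C2 (v : R -> R) : Prop :=
  forall i, cell_index N i -> C2_cell (X (i - 1)%Z) (X i) v.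

(** The space prescribes a polynomial only on the open cell; continuity forces agreement at the ends
    too, by passing the bound 0 of the difference to the closure. *)
Lemma fe_space_polyfun (v : R -> R) (i : Z) :
  fe_space k N X v -> cell_index N i ->
  exists p, polyfun k p /\ forall x, X (i - 1)%Z <= x <= X i -> v x = p x.
Proof.
  intros (Cv & _ & _ & Hv) Hi. destruct (HX i Hi) as (H1 & H2 & H3).
  destruct (Hv i Hi) as [q Hq].
  set (p := fun x => sum_f_R0 (fun j : nat => q j * x ^ j) k).
  assert (Pp : polyfun k p) by (now exists q).
  exists p. split; auto.
  destruct (polyfun_C2 k p Pp) as (_ & _ & _ & _ & _ & _ & Cp & _).
  intros x Hx. apply Rminus_diag_uniq.
  assert (B : Rabs (v (clamp x) - p x) <= 0).
  { apply (bound_closed_interval (fun x => v (clamp x) - p x) (X (i - 1)%Z) (X i)); auto.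
    - intros y. apply (continuous_minus (V:=R_NormedModule)); auto.
      now apply continuous_comp_clamp.
    - intros y Hy. rewrite clamp_id by lra. rewrite Hq by lra.
      unfold p. rewrite Rminus_diag, Rabs_R0. lra. }
  rewrite clamp_id in B by lra.
  generalize (Rabs_pos (v x - p x)). intros.
  destruct (Req_dec (v x - p x) 0) as [e|ne]; auto.
  apply Rabs_pos_lt in ne. lra.
Qed.

Lemma fe_space_piecewise_C2 (v : R -> R) : fe_space k N X v -> piecewise_C2 v.
Proof.
  intros Hv i Hi. destruct (fe_space_polyfun v i Hv Hi) as (p & Pp & Ep).
  now apply polyfun_C2_cell with k p.
Qed.

Lemma fe_space_minus (v w : R -> R) :
  fe_space k N X v -> fe_space k N X w -> fe_space k N X (fun x => v x - w x).
Proof.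
  intros (Cv & v0 & v1 & Hv) (Cw & w0 & w1 & Hw). split; [|split; [|split]].
  - intros x Hx. refine (filterlim_comp_2 v (fun y => opp (w y)) plus (Cv x Hx) _
      (filterlim_plus (v x) (opp (w x)))).
    apply (filterlim_comp _ _ _ w opp _ _ _ (Cw x Hx)), (filterlim_opp (w x)).
  - rewrite v0, w0; ring.
  - rewrite v1, w1; ring.
  - intros i Hi. destruct (Hv i Hi) as [p Hp]. destruct (Hw i Hi) as [q Hq].
    exists (fun j => p j - q j). intros x Hx. rewrite Hp, Hq by auto.
    rewrite <- minus_sum. apply sum_eq; intros; ring.
Qed.

(** Local pieces need to share only the nodal values of [u], so Taylor and affine pieces can be
    mixed from cell to cell; [P] carries the error bound along. *)
Lemma fe_interpolant (u : R -> R) (P : Z -> (R -> R) -> Prop) :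
  u (-1) = 0 -> u 1 = 0 ->
  (forall i, cell_index N i -> exists p, polyfun k p /\
     p (X (i - 1)%Z) = u (X (i - 1)%Z) /\ p (X i) = u (X i) /\ P i p) ->
  exists v, fe_space k N X v /\
    forall i, cell_index N i ->
      exists p, P i p /\ forall x, X (i - 1)%Z <= x <= X i -> v x = p x.
Proof.
  intros u0 u1 HP.
  set (Y := fun j : nat => X (Z.of_nat j - Z.of_nat N)%Z).
  set (idx := fun j : nat => (Z.of_nat j - Z.of_nat N + 1)%Z).
  assert (YS : forall j, Y (S j) = X (idx j)) by (intros; unfold Y, idx; f_equal; lia).
  assert (Y0 : forall j, Y j = X (idx j - 1)%Z) by (intros; unfold Y, idx; f_equal; lia).
  destruct (glue Y u (fun j p => polyfun k p /\ P (idx j) p) (2 * N))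
    as (v & Cv & vl & vr & Hv).
  - intros j Hj. rewrite YS, Y0. apply HX, cell_index_of_nat; lia.
  - intros j Hj. destruct (HP (idx j)) as (p & Pp & pl & pr & PP).
    apply cell_index_of_nat; lia.
    exists p. rewrite YS, Y0. split; auto.
    now destruct (polyfun_C2 k p Pp) as (_ & _ & _ & _ & _ & _ & Cp & _).
  - assert (Hcell : forall i, cell_index N i -> exists p, polyfun k p /\ P i p /\
              forall x, X (i - 1)%Z <= x <= X i -> v x = p x).
    { intros i Hi. unfold cell_index in Hi.
      destruct (Hv (Z.to_nat (i + Z.of_nat N - 1))) as (p & [Pp PP] & E). lia.
      rewrite YS, Y0 in E.
      replace (idx (Z.to_nat (i + Z.of_nat N - 1))) with i in * by (unfold idx; lia).
      exists p; auto. }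
    exists v. split; [split; [|split; [|split]]|].
    + apply continuous_I_of_pt; auto.
    + unfold Y in vl. simpl Z.of_nat in vl. rewrite Z.sub_0_l, X_left in vl. now rewrite vl.
    + unfold Y in vr. replace (Z.of_nat (2 * N) - Z.of_nat N)%Z with (Z.of_nat N) in vr by lia.
      rewrite X_right in vr. now rewrite vr.
    + intros i Hi. destruct (Hcell i Hi) as (p & [q Hq] & _ & E).
      exists q. intros x Hx. rewrite <- Hq. apply E; lra.
    + intros i Hi. destruct (Hcell i Hi) as (p & _ & PP & E). exists p; auto.
Qed.

Lemma inner_cells (g : R -> R) :
  (forall i, cell_index N i -> extends (X (i - 1)%Z) (X i) g) ->
  RInt g (-1) 1 = sum_cells N (fun i => RInt g (X (i - 1)%Z) (X i)).
Proof.
  intros Hg. rewrite <- X_left, <- X_right at 1. apply sum_cells_RInt; auto.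
  intros i Hi. destruct (HX i Hi). apply extends_ex_RInt; auto; lra.
Qed.

(** Merging the Galerkin and stabilisation parts into one integrand per cell allows all estimates to
    be made pointwise and integrated once. *)
Definition SD_density (d : R) (v w : R -> R) (x : R) : R :=
  eps * Derive v x * Derive w x + a x * Derive v x * w x + c x * v x * w x
  + d * ((- eps * Derive_n v 2 x + a x * Derive v x + c x * v x)
         * (a x * Derive w x)).

Lemma coefficients_extend (i : Z) (g : R -> R) :
  cell_index N i -> continuous_I g -> extends (X (i - 1)%Z) (X i) g.
Proof. intros Hi Hg. destruct (HX i Hi) as (? & ? & ?). now apply extends_continuous_I. Qed.

Let Ca0 : continuous_I a.
Proof. exact (class_C_continuous_I 0 1 a (le_S _ _ (le_n _)) Ca). Qed.

Let Ca1 : continuous_I (Derive a).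
Proof. exact (class_C_continuous_I 1 1 a (le_n _) Ca). Qed.

Lemma B_SD_cells (v w : R -> R) :
  piecewise_C2 v -> piecewise_C2 w ->
  B_SD eps a c N X delta v w
  = sum_cells N (fun i => RInt (SD_density (delta i) v w) (X (i - 1)%Z) (X i)).
Proof.
  intros Hv Hw. unfold B_SD, B_eps, B_stab, inner.
  assert (R : forall i, cell_index N i ->
    X (i - 1)%Z <= X i /\
    extends (X (i - 1)%Z) (X i) a /\ extends (X (i - 1)%Z) (X i) c /\
    extends (X (i - 1)%Z) (X i) v /\ extends (X (i - 1)%Z) (X i) (Derive v) /\
    extends (X (i - 1)%Z) (X i) (Derive_n v 2) /\
    extends (X (i - 1)%Z) (X i) w /\ extends (X (i - 1)%Z) (X i) (Derive w)).
  { intros i Hi. destruct (HX i Hi) as (? & ? & ?).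
    destruct (C2_cell_regular _ _ v (Hv i Hi)) as (? & ? & ? & _).
    destruct (C2_cell_regular _ _ w (Hw i Hi)) as (? & ? & ? & _).
    repeat split; auto using coefficients_extend. lra. }
  rewrite !inner_cells; try (intros i Hi; destruct (R i Hi) as (? & ? & ? & ? & ? & ? & ? & ?);
    extends_tac).
  rewrite !sum_cells_plus. apply sum_cells_ext; auto. intros i Hi.
  destruct (R i Hi) as (? & ? & ? & ? & ? & ? & ? & ?).
  rewrite <- RInt_scal_extends by (trivial; extends_tac).
  rewrite <- !RInt_plus_extends by (trivial; extends_tac).
  reflexivity.
Qed.

Lemma RHS_cells (f w : R -> R) :
  continuous_I f -> piecewise_C2 w ->
  inner f w + f_stab a f N X delta w
  = sum_cells N (fun i => RInt (fun x => f x * w x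
      + delta i * (f x * (a x * Derive w x))) (X (i - 1)%Z) (X i)).
Proof.
  intros Cf Hw. unfold inner, f_stab.
  assert (R : forall i, cell_index N i ->
    X (i - 1)%Z <= X i /\
    extends (X (i - 1)%Z) (X i) a /\ extends (X (i - 1)%Z) (X i) f /\
    extends (X (i - 1)%Z) (X i) w /\ extends (X (i - 1)%Z) (X i) (Derive w)).
  { intros i Hi. destruct (HX i Hi) as (? & ? & ?).
    destruct (C2_cell_regular _ _ w (Hw i Hi)) as (? & ? & ? & _).
    repeat split; auto using coefficients_extend. lra. }
  rewrite inner_cells; try (intros i Hi; destruct (R i Hi) as (? & ? & ? & ? & ?);
    extends_tac).
  rewrite sum_cells_plus. apply sum_cells_ext; auto. intros i Hi.
  destruct (R i Hi) as (? & ? & ? & ? & ?).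
  rewrite <- RInt_scal_extends by (trivial; extends_tac).
  rewrite <- !RInt_plus_extends by (trivial; extends_tac).
  reflexivity.
Qed.

Definition energy_density (d : R) (v : R -> R) (x : R) : R :=
  eps * Derive v x ^ 2 + v x ^ 2 + d * (a x * Derive v x) ^ 2.

Lemma norm_SD_cells (v : R -> R) :
  piecewise_C2 v ->
  norm_SD eps a N X delta v
  = sqrt (sum_cells N (fun i =>
      RInt (energy_density (delta i) v) (X (i - 1)%Z) (X i))).
Proof.
  intros Hv. unfold norm_SD. f_equal. unfold seminorm1.
  assert (R : forall i, cell_index N i ->
    X (i - 1)%Z <= X i /\
    extends (X (i - 1)%Z) (X i) a /\
    extends (X (i - 1)%Z) (X i) v /\ extends (X (i - 1)%Z) (X i) (Derive v)).
  { intros i Hi. destruct (HX i Hi) as (? & ? & ?).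
    destruct (C2_cell_regular _ _ v (Hv i Hi)) as (? & ? & ? & _).
    repeat split; auto using coefficients_extend. lra. }
  assert (L2 : forall g, (forall i, cell_index N i -> extends (X (i - 1)%Z) (X i) g) ->
    norm_L2 (-1) 1 g ^ 2
    = sum_cells N (fun i => RInt (fun x => g x ^ 2) (X (i - 1)%Z) (X i))).
  { intros g Hg.
    assert (E : forall i, cell_index N i ->
       extends (X (i - 1)%Z) (X i) (fun x => g x ^ 2)).
    { intros i Hi. apply extends_sqr; auto. }
    rewrite <- inner_cells by exact E. unfold norm_L2. apply pow2_sqrt.
    rewrite inner_cells by exact E.
    replace 0 with (sum_cells N (fun _ => 0)) by (rewrite sum_cells_const by auto; ring).
    apply sum_cells_le; auto. intros i Hi. destruct (R i Hi) as (? & _).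
    apply RInt_ge_0; auto. apply extends_ex_RInt; auto.
    intros; apply pow2_ge_0. }
  rewrite !L2; try (intros i Hi; now destruct (R i Hi) as (? & ? & ? & ?)).
  rewrite sum_cells_scal, !sum_cells_plus. apply sum_cells_ext; auto. intros i Hi.
  destruct (R i Hi) as (? & ? & ? & ?).
  rewrite norm_L2_sqr by (trivial; extends_tac).
  rewrite <- RInt_scal_extends by (trivial; extends_tac).
  rewrite <- !RInt_plus_extends by (trivial; extends_tac).
  apply RInt_ext_open; auto. intros x _. unfold energy_density.
  rewrite (Rpow_mult_distr (sqrt (delta i))), pow2_sqrt by (apply Hdelta; auto).
  reflexivity.
Qed.

(** The residual of [u] in the stabilisation is [f] itself. What remains of the Galerkin part is
    [eps (u' w' + u'' w)], an exact derivative; its cell contributions telescope and vanish because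
    [w] is 0 at -1 and 1. *)
Lemma Galerkin_consistency (f u w : R -> R) (m : nat) :
  class_C (S m) a -> class_C (S m) c -> class_C (S m) f ->
  bvp_solution eps a c f u -> fe_space k N X w ->
  B_SD eps a c N X delta u w = inner f w + f_stab a f N X delta w.
Proof.
  intros Ha Hc Hf Hu Hw.
  assert (HuC := solution_C2_cell eps a c f u m Heps Ha Hc Hf Hu).
  assert (Pu : piecewise_C2 u).
  { intros i Hi. destruct (HX i Hi) as (? & ? & ?).
    now apply (C2_cell_sub (-1) 1). }
  assert (Pw := fe_space_piecewise_C2 w Hw).
  assert (Cf : continuous_I f) by (apply (class_C_continuous_I 0 (S m)); auto; lia).
  rewrite B_SD_cells, RHS_cells by auto. apply Rminus_diag_uniq.
  rewrite sum_cells_minus.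
  destruct (C2_cell_regular _ _ _ HuC) as (_ & _ & _ & Du).
  destruct HuC as (u0 & u1 & u2 & C0 & C1 & C2 & E0 & E1 & E2).
  assert (Eu : forall x, -1 < x < 1 -> Derive u x = u1 x /\ Derive_n u 2 x = u2 x).
  { intros x Hx. destruct (derivatives_on_cell (-1) 1 u u0 u1 u2) with (x := x)
      as (? & ? & _); auto. intros; apply E0; lra. }
  (* The continuous representative [u1] stands in for [Derive u], whose values at -1 and 1 are
     uncontrolled. *)
  rewrite (sum_cells_ext N HN _ (fun i => (fun j => eps * (u1 (X j) * w (X j))) i
     - (fun j => eps * (u1 (X j) * w (X j))) (i - 1)%Z)).
  - rewrite (sum_cells_telescope N HN (fun j => eps * (u1 (X j) * w (X j)))).
    rewrite X_left, X_right. destruct Hw as (_ & w0 & w1 & _). rewrite w0, w1. ring.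
  - intros i Hi. destruct (HX i Hi) as (X1 & X2 & X3). cbv beta.
    destruct (C2_cell_regular _ _ u (Pu i Hi)) as (? & ? & ? & _).
    destruct (C2_cell_regular _ _ w (Pw i Hi)) as (? & ? & ? & _).
    assert (extends (X (i - 1)%Z) (X i) a) by auto using coefficients_extend.
    assert (extends (X (i - 1)%Z) (X i) c) by auto using coefficients_extend.
    assert (extends (X (i - 1)%Z) (X i) f) by auto using coefficients_extend.
    assert (extends (X (i - 1)%Z) (X i) u1) by (exists u1; auto).
    assert (extends (X (i - 1)%Z) (X i) u2) by (exists u2; auto).
    rewrite <- Rmult_minus_distr_l.
    rewrite <- (RInt_product _ _ u1 u2 w); auto; [|intros; apply E2; lra].
    rewrite <- RInt_scal_extends, <- RInt_minus_extends
      by (unfold SD_density; (extends_tac || lra)).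
    apply RInt_ext_open. lra. intros x Hx. unfold SD_density.
    destruct (Eu x) as [F1 F2]. lra.
    assert (Ef : - eps * Derive_n u 2 x + a x * Derive u x + c x * u x = f x).
    { apply Hu; lra. }
    rewrite Ef, <- Ef, <- F1, <- F2. ring.
Qed.

(** Squaring the inverse inequality produces [cinv ^ 2 / h ^ 2], which the bound on [delta i]
    cancels up to [/ 2 * eps]. In the alternative for linear elements the second derivative is 0
    inside the cell. *)
Lemma delta_coercivity_cell (cinv : R) (w : R -> R) (i : Z) :
  0 < cinv -> 0 < sup_norm c ->
  inverse_inequality cinv k N X -> delta_coercivity eps gamma cinv c k N X delta ->
  fe_space k N X w -> cell_index N i ->
  delta i * sup_norm c ^ 2 <= gamma / 2 /\
  delta i * eps ^ 2 * RInt (fun x => Derive_n w 2 x ^ 2) (X (i - 1)%Z) (X i)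
    <= / 2 * eps * RInt (fun x => Derive w x ^ 2) (X (i - 1)%Z) (X i).
Proof.
  intros Hcinv Hs Hinv Hd Hw Hi. destruct (HX i Hi) as (X1 & X2 & X3).
  destruct (C2_cell_regular _ _ w (fe_space_piecewise_C2 w Hw i Hi))
    as (W0 & W1 & W2 & _).
  assert (Ps : 0 < sup_norm c ^ 2) by (apply pow_lt; auto).
  assert (I1 : 0 <= RInt (fun x => Derive w x ^ 2) (X (i - 1)%Z) (X i)).
  { rewrite <- norm_L2_sqr by (auto; lra). apply pow2_ge_0. }
  assert (Es : gamma / sup_norm c ^ 2 * sup_norm c ^ 2 = gamma) by (field; lra).
  destruct Hd as [Hd|[K1 Hd]]; specialize (Hd i Hi).
  - set (h := step X i) in *.
    assert (Hh : 0 < h) by (unfold h, step; lra).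
    assert (D1 := Rle_trans _ _ _ (proj2 Hd)
      (Rmult_le_compat_l (1 / 2) _ _ ltac:(lra) (Rmin_l _ _))).
    assert (D2 := Rle_trans _ _ _ (proj2 Hd)
      (Rmult_le_compat_l (1 / 2) _ _ ltac:(lra) (Rmin_r _ _))).
    split.
    + apply Rmult_le_compat_r with (r := sup_norm c ^ 2) in D2; lra.
    + specialize (Hinv i w Hi Hw). fold h in Hinv.
      assert (Hinv2 := pow_incr (norm_L2 _ _ (Derive_n w 2)) _ 2
        (conj (sqrt_pos _) Hinv)).
      rewrite 2!Rpow_mult_distr, 2!norm_L2_sqr in Hinv2 by (auto; lra).
      assert (P : 0 < eps * cinv ^ 2) by (apply Rmult_lt_0_compat; auto; now apply pow_lt).
      apply Rle_trans with (1 / 2 * (h ^ 2 / (eps * cinv ^ 2)) * eps ^ 2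
        * (cinv ^ 2 * (/ h) ^ 2 * RInt (fun x => Derive w x ^ 2) (X (i - 1)%Z) (X i))).
      apply Rmult_le_compat; auto.
      apply Rmult_le_pos. lra. apply pow2_ge_0.
      rewrite <- norm_L2_sqr by (auto; lra). apply pow2_ge_0.
      apply Rmult_le_compat_r; auto. apply pow2_ge_0.
      right; field. split; lra.
  - split.
    + apply proj2, Rmult_le_compat_r with (r := sup_norm c ^ 2) in Hd; [|lra].
      replace (gamma / (2 * sup_norm c ^ 2) * sup_norm c ^ 2) with (gamma / 2) in Hd
        by (field; lra). lra.
    + destruct (fe_space_polyfun w i Hw Hi) as (p & Pp & Ep). subst k.
      rewrite (RInt_ext_open _ _ (fun x => Derive_n w 2 x ^ 2) (fun x => 0 * 0)).
      * rewrite RInt_scal_extends by (apply extends_const || lra). nra.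
      * lra.
      * intros x Hx. rewrite (affine_C2_cell (X (i - 1)%Z) (X i) w p); auto. ring.
        intros; apply Ep; lra.
Qed.

Definition coercive_density (d : R) (v : R -> R) (x : R) : R :=
  eps * Derive v x ^ 2 + gamma * v x ^ 2 + d * (a x * Derive v x) ^ 2.

(** Integration by parts turns [(a w', w)] into [-(a' w, w) / 2], which with [c] gives at least
    [gamma]. In the stabilisation two Young inequalities each take a quarter of [d (a w')^2]; their
    remainders [d (eps w'')^2] and [d (c w)^2] are absorbed by half of the diffusion and half of the
    [gamma] term. One half of everything is left. *)
Lemma SD_coercivity (cinv : R) (w : R -> R) :
  0 < cinv -> 0 < sup_norm c ->
  (forall x, -1 < x < 1 -> Rabs (c x) <= sup_norm c) ->
  (forall x, -1 <= x <= 1 -> gamma <= c x - 1 / 2 * Derive a x) ->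
  inverse_inequality cinv k N X -> delta_coercivity eps gamma cinv c k N X delta ->
  fe_space k N X w ->
  / 2 * sum_cells N (fun i =>
          RInt (coercive_density (delta i) w) (X (i - 1)%Z) (X i))
  <= sum_cells N (fun i => RInt (SD_density (delta i) w w) (X (i - 1)%Z) (X i)).
Proof.
  intros Hcinv Hs0 Hs Hg Hinv Hd Hw.
  assert (Pw := fe_space_piecewise_C2 w Hw).
  (* The boundary term of each cell is added so that the inequality holds cell by cell; over the
     whole mesh these terms sum to 0. *)
  assert (Hcell : forall i, cell_index N i ->
    / 2 * RInt (coercive_density (delta i) w) (X (i - 1)%Z) (X i)
    + ((fun j => / 2 * (a (X j) * w (X j) * w (X j))) i
       - (fun j => / 2 * (a (X j) * w (X j) * w (X j))) (i - 1)%Z)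
    <= RInt (SD_density (delta i) w w) (X (i - 1)%Z) (X i)).
  { intros i Hi. cbv beta. destruct (HX i Hi) as (X1 & X2 & X3).
    destruct (delta_coercivity_cell cinv w i) as [D1 D2]; auto.
    destruct (Hdelta i Hi) as [D0 _].
    destruct (C2_cell_regular _ _ w (Pw i Hi)) as (W0 & W1 & W2 & Dw).
    assert (A0 := coefficients_extend i a Hi Ca0).
    assert (A1 := coefficients_extend i (Derive a) Hi Ca1).
    assert (C0 := coefficients_extend i c Hi Cc).
    set (l := X (i - 1)%Z) in *. set (r := X i) in *. set (d := delta i) in *.
    destruct (fe_space_polyfun w i Hw Hi) as (p & Pp & Ep).
    fold l r in Ep.
    destruct (polyfun_C2 k p Pp) as (p1 & _ & _ & _ & Dp & _ & Cp & _).
    assert (E : RInt (fun x => (Derive a x * w x + a x * Derive w x) * w x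
                  + (a x * w x) * Derive w x) l r
              = a r * w r * w r - a l * w l * w l).
    (* [RInt_product] wants a factor continuous on the whole line, so [a] is clamped and [w] is
       replaced by its polynomial on the cell. *)
    { transitivity (RInt (fun x => (Derive a x * w x + a x * Derive w x) * w x
                  + (a (clamp x) * p x) * Derive w x) l r).
      { apply RInt_ext_open. lra. intros x Hx. rewrite clamp_id, Ep by lra. reflexivity. }
      rewrite (RInt_product l r (fun x => a (clamp x) * p x)
        (fun x => Derive a x * w x + a x * Derive w x) w X2).
      - rewrite !clamp_id, <- !Ep by lra. reflexivity.
      - intros x. apply (continuous_mult (K:=R_AbsRing)); auto.
        now apply continuous_comp_clamp.
      - intros x Hx. apply (is_derive_ext_open l r x _ (fun x => a x * w x)); auto.
        intros y Hy. rewrite clamp_id, Ep by lra. reflexivity.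
        apply (is_derive_mult a w x (Derive a x) (Derive w x)).
        apply Derive_correct. apply (Ca 1%nat x); lia || lra.
        now apply Dw. intros; apply Rmult_comm.
      - extends_tac.
      - exact (Pw i Hi). }
    apply Rle_trans with (RInt (fun x =>
      / 2 * (eps * Derive w x ^ 2 + gamma * w x ^ 2 + d * (a x * Derive w x) ^ 2)
      + (/ 2 * eps * Derive w x ^ 2 - d * eps ^ 2 * Derive_n w 2 x ^ 2)
      + / 2 * ((Derive a x * w x + a x * Derive w x) * w x
               + (a x * w x) * Derive w x)) l r).
    - unfold coercive_density.
      rewrite (RInt_combination l r (/ 2) (/ 2 * eps) (d * eps ^ 2) (/ 2)
        (fun x => eps * Derive w x ^ 2 + gamma * w x ^ 2 + d * (a x * Derive w x) ^ 2)
        (fun x => Derive w x ^ 2) (fun x => Derive_n w 2 x ^ 2)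
        (fun x => (Derive a x * w x + a x * Derive w x) * w x
               + (a x * w x) * Derive w x)) by (extends_tac || lra).
      rewrite E. lra.
    - apply RInt_le_extends.
      lra. extends_tac. unfold SD_density. extends_tac.
      intros x Hx. unfold SD_density.
      assert (G := Hg x ltac:(lra)).
      assert (S : d * c x ^ 2 <= gamma / 2).
      { apply Rle_trans with (2 := D1). apply Rmult_le_compat_l; auto.
        apply sqr_le, Hs; lra. }
      set (A := a x * Derive w x). set (e := eps * Derive_n w 2 x).
      (* Expanding the squares gives the two Young inequalities, each using a quarter of
         [d * A ^ 2]. *)
      assert (Q1 : 0 <= d * (A / 2 - e) ^ 2) by (apply Rmult_le_pos; auto; apply pow2_ge_0).
      assert (Q2 : 0 <= d * (A / 2 + c x * w x) ^ 2)
        by (apply Rmult_le_pos; auto; apply pow2_ge_0).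
      assert (Q3 : d * c x ^ 2 * w x ^ 2 <= gamma / 2 * w x ^ 2)
        by (apply Rmult_le_compat_r; auto; apply pow2_ge_0).
      assert (Q4 : gamma * w x ^ 2 <= (c x - 1 / 2 * Derive a x) * w x ^ 2)
        by (apply Rmult_le_compat_r; auto; apply pow2_ge_0).
      unfold A, e in *. nra. }
  rewrite sum_cells_scal.
  rewrite <- (Rplus_0_r (sum_cells N (fun i => / 2 * _))).
  replace 0 with (sum_cells N (fun i => (fun j => / 2 * (a (X j) * w (X j) * w (X j))) i
       - (fun j => / 2 * (a (X j) * w (X j) * w (X j))) (i - 1)%Z)).
  - rewrite sum_cells_plus. now apply sum_cells_le.
  - rewrite (sum_cells_telescope N HN (fun j => / 2 * (a (X j) * w (X j) * w (X j)))).
    rewrite X_left, X_right. destruct Hw as (_ & w0 & w1 & _). rewrite w0, w1. ring.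
Qed.

(** This is the remainder that [young_split] leaves. [interpolation_error] is the variant with [x]
    in place of [a], which keeps the cell estimates free of [a]. *)
Definition stability_error (d : R) (u p : R -> R) (x : R) : R :=
  eps * (Derive u x - Derive p x) ^ 2 + (a x * (Derive u x - Derive p x)) ^ 2
  + (u x - p x) ^ 2 + d * (eps * (Derive_n u 2 x - Derive_n p 2 x)) ^ 2.

(** With [w = uI - uN], coercivity bounds half of [Q] by the form at [(w, w)], orthogonality turns
    this into minus the form at [(u - uI, w)], and Young returns a quarter of [Q]. The factor 8 is 4
    from that quarter times 2 from splitting [u - uN]; division by [Rmin 1 gamma] passes from the
    coercive density to the energy. *)
Lemma SD_error_estimate (cinv : R) (u uN uI : R -> R) (CC : Z -> R) :
  0 < cinv -> 0 < sup_norm c ->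
  (forall x, -1 < x < 1 -> Rabs (c x) <= sup_norm c) ->
  (forall x, -1 <= x <= 1 -> gamma <= c x - 1 / 2 * Derive a x) ->
  inverse_inequality cinv k N X -> delta_coercivity eps gamma cinv c k N X delta ->
  piecewise_C2 u -> fe_space k N X uN -> fe_space k N X uI ->
  (forall w, fe_space k N X w ->
     B_SD eps a c N X delta u w = B_SD eps a c N X delta uN w) ->
  (forall i x, cell_index N i -> X (i - 1)%Z < x < X i ->
     stability_error (delta i) u uI x <= CC i) ->
  norm_SD eps a N X delta (fun x => u x - uN x)
  <= sqrt ((8 * (4 + 2 / gamma + 2 * Mc ^ 2 / gamma + 3 * D + 3 * D * Mc ^ 2)
              / Rmin 1 gamma + 2 * (1 + D))
           * sum_cells N (fun i => CC i * (X i - X (i - 1)%Z))).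
Proof.
  intros Hcinv Hs0 Hs Hg Hinv Hd Pu HuN HuI HGal HCC.
  set (K0 := 4 + 2 / gamma + 2 * Mc ^ 2 / gamma + 3 * D + 3 * D * Mc ^ 2).
  set (w := fun x => uI x - uN x). set (S := sum_cells N (fun i => CC i * (X i - X (i - 1)%Z))).
  assert (Hw : fe_space k N X w) by (now apply fe_space_minus).
  assert (PN := fe_space_piecewise_C2 uN HuN).
  assert (PI := fe_space_piecewise_C2 uI HuI).
  assert (Pw := fe_space_piecewise_C2 w Hw).
  assert (Pe : piecewise_C2 (fun x => u x - uN x)).
  { intros i Hi. now destruct (C2_cell_minus _ _ u uN (Pu i Hi) (PN i Hi)). }
  rewrite norm_SD_cells by auto. apply sqrt_le_1_alt.
  assert (g0 : 0 < Rmin 1 gamma) by (apply Rmin_glb_lt; lra).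
  assert (D0 : 0 <= D).
  { assert (C : cell_index N 1) by (unfold cell_index; lia).
    destruct (Hdelta 1%Z C); lra. }
  set (Q := sum_cells N (fun i =>
    RInt (coercive_density (delta i) w) (X (i - 1)%Z) (X i))).
  (* Triangle inequality in squared pointwise form: the square of [e + z] is at most twice the sum
     of the squares. *)
  assert (HE : sum_cells N (fun i =>
      RInt (energy_density (delta i) (fun x => u x - uN x)) (X (i - 1)%Z) (X i))
      <= 2 / Rmin 1 gamma * Q + 2 * (1 + D) * S).
  { unfold Q, S. rewrite !sum_cells_scal, sum_cells_plus. apply sum_cells_le; auto.
    intros i Hi. destruct (HX i Hi) as (X1 & X2 & X3).
    destruct (C2_cell_regular _ _ w (Pw i Hi)) as (? & ? & ? & _).
    destruct (C2_cell_regular _ _ _ (Pe i Hi)) as (? & ? & ? & _).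
    assert (extends (X (i - 1)%Z) (X i) a) by auto using coefficients_extend.
    destruct (C2_cell_minus _ _ u uN (Pu i Hi) (PN i Hi)) as [_ DN].
    destruct (C2_cell_minus _ _ uI uN (PI i Hi) (PN i Hi)) as [_ DI].
    destruct (Hdelta i Hi) as [d0 d1].
    assert (EQ : extends (X (i - 1)%Z) (X i) (coercive_density (delta i) w))
      by (unfold coercive_density; extends_tac).
    apply Rle_trans with (RInt (fun x => 2 / Rmin 1 gamma * coercive_density (delta i) w x
      + 2 * (1 + D) * CC i) (X (i - 1)%Z) (X i)).
    - apply RInt_le_extends.
      lra. unfold energy_density; extends_tac. extends_tac.
      intros x Hx. specialize (HCC i x Hi Hx).
      destruct (DN x Hx) as [DN1 _]. destruct (DI x Hx) as [DI1 _].
      unfold energy_density, coercive_density, w. rewrite DN1, DI1.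
      unfold stability_error in HCC.
      set (e0 := u x - uI x) in *. set (e1 := Derive u x - Derive uI x) in *.
      set (e2 := Derive_n u 2 x - Derive_n uI 2 x) in *.
      set (z0 := uI x - uN x). set (z1 := Derive uI x - Derive uN x).
      replace (u x - uN x) with (e0 + z0) by (unfold e0, z0; ring).
      replace (Derive u x - Derive uN x) with (e1 + z1) by (unfold e1, z1; ring).
      assert (P1 := pow2_ge_0 z0). assert (P2 := pow2_ge_0 z1).
      assert (P3 := pow2_ge_0 e0). assert (P4 := pow2_ge_0 e1).
      assert (P5 := pow2_ge_0 (a x * z1)). assert (P6 := pow2_ge_0 (a x * e1)).
      assert (P7 := pow2_ge_0 (eps * e2)).
      assert (R1 : eps * z1 ^ 2 + z0 ^ 2 + delta i * (a x * z1) ^ 2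
        <= / Rmin 1 gamma * (eps * z1 ^ 2 + gamma * z0 ^ 2 + delta i * (a x * z1) ^ 2)).
      { apply Rmult_le_reg_l with (Rmin 1 gamma); auto.
        rewrite <- Rmult_assoc, Rinv_r, Rmult_1_l by lra.
        assert (m1 := Rmin_l 1 gamma). assert (m2 := Rmin_r 1 gamma).
        assert (0 <= eps * z1 ^ 2) by (apply Rmult_le_pos; lra).
        assert (0 <= delta i * (a x * z1) ^ 2) by (apply Rmult_le_pos; lra).
        nra. }
      assert (R2 : delta i * (a x * e1) ^ 2 <= D * (a x * e1) ^ 2)
        by (apply Rmult_le_compat_r; lra).
      assert (R3 : 0 <= delta i * (eps * e2) ^ 2) by (apply Rmult_le_pos; lra).
      assert (R4 : 0 <= eps * e1 ^ 2) by (apply Rmult_le_pos; lra).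
      assert (R5 : eps * (e1 + z1) ^ 2 <= 2 * (eps * e1 ^ 2) + 2 * (eps * z1 ^ 2)).
      { assert (0 <= eps * (e1 - z1) ^ 2) by (apply Rmult_le_pos; [lra | apply pow2_ge_0]). lra. }
      assert (R6 : (e0 + z0) ^ 2 <= 2 * e0 ^ 2 + 2 * z0 ^ 2).
      { assert (T := pow2_ge_0 (e0 - z0)). lra. }
      assert (R7 : delta i * (a x * (e1 + z1)) ^ 2
        <= 2 * (delta i * (a x * e1) ^ 2) + 2 * (delta i * (a x * z1) ^ 2)).
      { assert (0 <= delta i * (a x * (e1 - z1)) ^ 2)
          by (apply Rmult_le_pos; [lra | apply pow2_ge_0]). lra. }
      assert (R8 : (1 + D) * (eps * e1 ^ 2 + (a x * e1) ^ 2 + e0 ^ 2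
                      + delta i * (eps * e2) ^ 2) <= (1 + D) * CC i)
        by (apply Rmult_le_compat_l; lra).
      assert (R9 : 0 <= D * (eps * e1 ^ 2 + e0 ^ 2 + delta i * (eps * e2) ^ 2))
        by (apply Rmult_le_pos; lra).
      unfold Rdiv. lra.
    - right. rewrite (RInt_plus_extends _ _
        (fun x => 2 / Rmin 1 gamma * coercive_density (delta i) w x)
        (fun _ => 2 * (1 + D) * CC i)) by (extends_tac || lra).
      rewrite RInt_scal_extends by (auto; lra).
      rewrite RInt_constant. ring. }
  assert (HQ : / 4 * Q <= K0 * S).
  { assert (Coe := SD_coercivity cinv w Hcinv Hs0 Hs Hg Hinv Hd Hw). fold Q in Coe.
    assert (Gal := Rminus_diag_eq _ _ (HGal w Hw)).
    rewrite !B_SD_cells, sum_cells_minus in Gal by auto.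
    (* By bilinearity the density at [(w, w)] equals that at [(u, w)] minus that at [(uN, w)] minus
       that at [(u - uI, w)]. [young_split] bounds the last term; the difference of the others sums
       to 0 by [Gal]. *)
    assert (L : sum_cells N (fun i => RInt (SD_density (delta i) w w) (X (i - 1)%Z) (X i))
      <= sum_cells N (fun i =>
           RInt (SD_density (delta i) u w) (X (i - 1)%Z) (X i)
           - RInt (SD_density (delta i) uN w) (X (i - 1)%Z) (X i)) + (/ 4 * Q + K0 * S)).
    { unfold Q, S. rewrite !sum_cells_scal, !sum_cells_plus. apply sum_cells_le; auto.
      intros i Hi. destruct (HX i Hi) as (X1 & X2 & X3).
      destruct (C2_cell_regular _ _ w (Pw i Hi)) as (? & ? & ? & _).
      destruct (C2_cell_regular _ _ _ (Pu i Hi)) as (? & ? & ? & _).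
      destruct (C2_cell_regular _ _ _ (PN i Hi)) as (? & ? & ? & _).
      assert (extends (X (i - 1)%Z) (X i) a) by auto using coefficients_extend.
      assert (extends (X (i - 1)%Z) (X i) c) by auto using coefficients_extend.
      destruct (C2_cell_minus _ _ uI uN (PI i Hi) (PN i Hi)) as [_ DI].
      destruct (Hdelta i Hi) as [d0 d1].
      set (l := X (i - 1)%Z) in *. set (r := X i) in *.
      assert (EQ : extends l r (coercive_density (delta i) w))
        by (unfold coercive_density; extends_tac).
      assert (Ew : extends l r (SD_density (delta i) w w)) by (unfold SD_density; extends_tac).
      assert (Eu : extends l r (SD_density (delta i) u w)) by (unfold SD_density; extends_tac).
      assert (EN : extends l r (SD_density (delta i) uN w)) by (unfold SD_density; extends_tac).
      rewrite <- RInt_minus_extends by (trivial; lra).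
      rewrite <- (RInt_scal_extends l r (/ 4)) by (trivial; lra).
      assert (EC : K0 * (CC i * (r - l)) = RInt (fun _ => K0 * CC i) l r)
        by (rewrite RInt_constant; ring).
      rewrite EC.
      rewrite <- 2!RInt_plus_extends by (extends_tac || lra).
      apply RInt_le_extends; [lra | assumption | extends_tac |].
      intros x Hx. specialize (HCC i x Hi Hx). destruct (DI x Hx) as [DI1 DI2].
      assert (Cx : c x ^ 2 <= Mc ^ 2).
      { apply sqr_le, HMc. unfold l, r in *; lra. }
      assert (Y := young_split eps gamma D Mc (a x) (c x) (delta i) (u x - uI x)
        (Derive u x - Derive uI x) (Derive_n u 2 x - Derive_n uI 2 x)
        (w x) (Derive w x) Heps Hgamma (conj d0 d1) Cx).
      fold K0 in Y. unfold stability_error in HCC.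
      assert (K0p : 0 <= K0).
      { unfold K0. assert (0 < / gamma) by (apply Rinv_0_lt_compat; lra).
        assert (M2 := pow2_ge_0 Mc).
        assert (0 <= Mc ^ 2 * / gamma) by (apply Rmult_le_pos; lra).
        assert (0 <= D * Mc ^ 2) by (apply Rmult_le_pos; lra).
        unfold Rdiv. lra. }
      apply (Rmult_le_compat_l K0) in HCC; auto.
      unfold coercive_density, SD_density.
      replace (Derive_n w 2 x) with (Derive_n uI 2 x - Derive_n uN 2 x) by (now rewrite <- DI2).
      replace (Derive w x) with (Derive uI x - Derive uN x) in * by (now rewrite <- DI1).
      replace (w x) with (uI x - uN x) in * by reflexivity.
      lra. }
    lra. }
  apply Rle_trans with (1 := HE).
  assert (HQ' : / Rmin 1 gamma * Q <= / Rmin 1 gamma * (4 * (K0 * S))).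
  { apply Rmult_le_compat_l. left; apply Rinv_0_lt_compat; auto. lra. }
  unfold Rdiv in *. lra.
Qed.

End Energy.

(** * Constants uniform in [eps] and [N], and the assembly *)

Lemma sup_norm_upper_bound (g : R -> R) (x : R) :
  continuous_I g -> -1 < x < 1 -> Rabs (g x) <= sup_norm g.
Proof.
  intros Hg Hx. destruct (bounded_continuous_I g Hg) as (M & _ & HM).
  unfold sup_norm.
  set (E := fun y : R => exists x : R, -1 < x < 1 /\ y = Rabs (g x)).
  destruct (Lub_Rbar_correct E) as [UB LUB].
  (* Finiteness has to be secured first: [real] would send an infinite supremum to 0. *)
  assert (B : Rbar_le (Lub_Rbar E) M).
  { apply LUB. intros y [z [Hz ->]]. apply HM; lra. }
  assert (A : Rbar_le (Rabs (g x)) (Lub_Rbar E)) by (apply UB; now exists x).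
  destruct (Lub_Rbar E) as [v| |]; simpl in *; tauto.
Qed.

(** [K + 1] is at most 2 plus a multiple of [ln N]; from [N >= 2] on, [ln N >= ln 2] absorbs the
    2. *)
Lemma ln_dominates_mesh_K (k : nat) (lambda : R) :
  0 < lambda -> lambda < INR (k + 1) ->
  exists Q, 0 < Q /\
    forall eps N, 0 < eps <= 1 -> (2 <= N)%nat ->
      INR (mesh_K k lambda eps N + 1) <= Q * ln (INR N).
Proof.
  intros Hl Hk. exists (2 / ln 2 + INR (2 * k + 1) / ln 10).
  assert (L2 : 0 < ln 2) by (rewrite <- ln_1; apply ln_increasing; lra).
  assert (L10 : 0 < ln 10) by (rewrite <- ln_1; apply ln_increasing; lra).
  assert (0 < / ln 2) by (now apply Rinv_0_lt_compat).
  assert (0 <= INR (2 * k + 1) / ln 10)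
    by (apply Rmult_le_pos; [apply pos_INR | left; now apply Rinv_0_lt_compat]).
  split. { unfold Rdiv in *. lra. }
  intros eps N Heps HN.
  destruct (mesh_K_bounds k N lambda eps) as [_ B]; auto. lia.
  rewrite plus_INR. simpl (INR 1).
  assert (LN : ln 2 <= ln (INR N)).
  { apply ln_le. lra. apply (le_INR 2); auto. }
  assert (1 <= / ln 2 * ln (INR N)).
  { apply Rmult_le_reg_l with (ln 2); auto.
    rewrite <- Rmult_assoc, Rinv_r; lra. }
  unfold Rdiv in *. lra.
Qed.

Lemma interpolation_error_ext (eps d l r : R) (k : nat) (u v p : R -> R) (x : R) :
  polyfun k p -> (forall y, l <= y <= r -> v y = p y) -> l < x < r ->
  interpolation_error eps d u v x = interpolation_error eps d u p x.
Proof.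
  intros Pp E Hx. destruct (polyfun_C2 k p Pp) as (p1 & p2 & _ & _ & D1 & D2 & _).
  destruct (derivatives_on_cell l r v p p1 p2) with (x := x) as (V1 & V2 & _); auto.
  { intros; apply E; lra. }
  destruct (derivatives_on_cell l r p p p1 p2) with (x := x) as (P1 & P2 & _); auto.
  unfold interpolation_error. rewrite V1, V2, P1, P2, E by lra. reflexivity.
Qed.

(* [1 + / (N h)] integrates over the cell to [h + / N]; the latter sums to 4, the
   term [/ N] being there to absorb the innermost cells. *)
Lemma mesh_cell_interpolant (k N : nat) (eps lambda C D d : R) (u uc : R -> R) (i : Z) :
  (0 < N)%nat -> 0 < eps <= 1 -> 0 < lambda -> lambda < INR (S k + 1) ->
  0 < C -> 0 <= D ->
  let K := mesh_K (S k) lambda eps N in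
  let X := mesh (S k) lambda eps N in
  let H := INR (K + 1) / INR N in
  Nat.divide (K + 1) N -> cell_index N i ->
  (forall x, continuous uc x) -> (forall x, -1 <= x <= 1 -> u x = uc x) ->
  (forall j x, (j <= S k)%nat -> -1 < x < 1 ->
     is_derive (Derive_n u j) x (Derive_n u (S j) x)) ->
  (forall x, -1 < x < 1 ->
      (forall j, (j <= S k + 1)%nat ->
         (sqrt eps + Rabs x) ^ j * Rabs (Derive_n u j x) <= C) /\
      Rpower eps ((1 - lambda / INR (S k + 1)) / 2) ^ (S k + 1)
        * Rabs (Derive_n u (S k + 1) x) <= C) ->
  0 <= d <= D -> d * eps <= D * step X i ^ 2 ->
  exists p, polyfun (S k) p /\ p (X (i - 1)%Z) = u (X (i - 1)%Z) /\ p (X i) = u (X i) /\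
    forall x, X (i - 1)%Z < x < X i ->
      interpolation_error eps d u p x
      <= ((2205 + D) * (C * 9 ^ S k) ^ 2 + (45 + D) * C ^ 2)
         * (H ^ S k) ^ 2 * (1 + / (INR N * step X i)).
Proof.
  intros HN Heps Hl Hk HC HD K X H HK Hi Cu Eu Du B Hd0 Hd.
  destruct (mesh_cell_shape K N HN HK i Hi) as (X1 & X2 & X3 & Shape).
  change (IZR (Z.sgn (i - 1)) * half_mesh K N (Z.abs_nat (i - 1)))
    with (X (i - 1)%Z) in *.
  change (IZR (Z.sgn i) * half_mesh K N (Z.abs_nat i)) with (X i) in *.
  fold H in Shape. destruct (mesh_ratio K N HN HK) as (_ & H01 & HNH). fold H in H01, HNH.
  unfold step in *. set (l := X (i - 1)%Z) in *. set (r := X i) in *.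
  assert (PN : 1 <= INR N) by (apply (le_INR 1); lia).
  assert (IN : 0 < / INR N) by (apply Rinv_0_lt_compat; lra).
  set (CG := (2205 + D) * (C * 9 ^ S k) ^ 2). set (CB := (45 + D) * C ^ 2).
  assert (GG : 0 <= CG) by (apply Rmult_le_pos; [lra | apply pow2_ge_0]).
  assert (GB : 0 <= CB) by (apply Rmult_le_pos; [lra | apply pow2_ge_0]).
  set (Hk2 := (H ^ S k) ^ 2). assert (PH : 0 <= Hk2) by apply pow2_ge_0.
  assert (IW : 0 < / (INR N * (r - l))).
  { apply Rinv_0_lt_compat, Rmult_lt_0_compat; lra. }
  (* This covers every cell with an admissible scale [tau]; the factor [1 + / (N h)] exceeds 1, so
     it may be inserted freely. *)
  assert (Good : forall tau, 0 < tau -> sqrt eps <= tau -> r - l <= 9 * H * tau ->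
    (forall x, l < x < r -> Rabs x <= 10 * tau) ->
    (forall x, l < x < r -> tau ^ S (S k) * Rabs (Derive_n u (S (S k)) x) <= C) ->
    exists p, polyfun (S k) p /\ p l = u l /\ p r = u r /\
      forall x, l < x < r ->
        interpolation_error eps d u p x
        <= (CG + CB) * Hk2 * (1 + / (INR N * (r - l)))).
  { intros tau T1 T2 T3 T4 T5.
    destruct (taylor_cell_error k eps d D C l r u uc) with (H := H) (tau := tau)
      as (p & Pp & pl & pr & E); auto; try lra.
    { intros; apply Eu; lra. } { intros; apply Du; auto; lra. }
    exists p. split; auto. split; auto. split; auto.
    intros x Hx. apply Rle_trans with (1 := E x Hx). fold CG Hk2.
    assert (0 <= CB * Hk2) by (apply Rmult_le_pos; auto).
    assert (0 <= CG * Hk2) by (apply Rmult_le_pos; auto).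
    assert (0 <= (CG + CB) * Hk2 * / (INR N * (r - l))).
    { apply Rmult_le_pos; lra. }
    lra. }
  assert (ek : (S k + 1)%nat = S (S k)) by lia.
  assert (Pe : 0 < sqrt eps) by (apply sqrt_lt_R0; lra).
  destruct Shape as [[Sh Sx]|(delta & Pd & Sh & Sx)].
  - destruct (mesh_K_bounds (S k) N lambda eps HN Heps Hl Hk) as [Kb _].
    fold K in Kb. unfold mesh_sigma in Kb.
    set (theta := (1 - lambda / INR (S k + 1)) / 2) in *.
    (* The larger entry of [sigma] bounds the innermost breakpoint; which one it is decides between
       the Taylor and the affine interpolant. *)
    destruct (Rle_dec (/ INR N ^ (2 * S k + 1)) (Rpower eps theta)) as [L|L].
    + rewrite Rmax_left in Kb by auto.
      apply (Good (Rpower eps theta)). apply exp_pos.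
      * rewrite <- Rpower_sqrt by lra. apply exp_monotone.
        assert (Th := theta_bounds (S k) lambda Hl Hk). fold theta in Th.
        assert (Le : ln eps <= 0) by (rewrite <- ln_1; apply ln_le; lra).
        nra.
      * rewrite Sh. nra.
      * intros x Hx. specialize (Sx x ltac:(lra)).
        assert (0 < Rpower eps theta) by apply exp_pos. lra.
      * intros x Hx. rewrite <- ek. apply B; lra.
    + rewrite Rmax_right in Kb by lra.
      destruct (affine_cell_error k eps d D C l r u uc) as (p & Pp & pl & pr & E); auto.
      { intros; apply Eu; lra. } { intros; apply Du; auto; lra. }
      { intros x Hx j Hj. apply B; lra || lia. }
      exists p. split. { apply polyfun_le with 1%nat; auto; lia. }
      split; auto. split; auto.
      intros x Hx. apply Rle_trans with (1 := E x Hx). fold CB.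
      (* Here the exponent [2 * S k + 1] is spent: one power cancels [N], the others become [H]
         through [/ N <= H]. So [Hk2 / (N h) >= 1], and a merely bounded error fits under the
         claimed bound. *)
      assert (Lk : (r - l) * INR N <= Hk2).
      { apply Rle_trans with (/ INR N ^ (2 * S k)).
        - rewrite Sh. replace (2 * S k + 1)%nat with (S (2 * S k)) in Kb by lia.
          rewrite <- tech_pow_Rmult, Rinv_mult in Kb.
          assert (Pk : 0 < / INR N ^ (2 * S k)) by (apply Rinv_0_lt_compat, pow_lt; lra).
          apply Rle_trans with (1 * (/ INR N * / INR N ^ (2 * S k)) * INR N).
          apply Rmult_le_compat_r. lra. apply Rmult_le_compat; try lra.
          left; apply Rinv_0_lt_compat, pow_lt; lra.
          rewrite Rmult_1_l, (Rmult_comm (/ INR N)), Rmult_assoc, Rinv_l by lra. lra.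
        - unfold Hk2. rewrite <- pow_mult, Nat.mul_comm, <- pow_inv.
          apply pow_incr. lra. }
      assert (Lh : 1 <= Hk2 * / (INR N * (r - l))).
      { apply Rmult_le_reg_r with (INR N * (r - l)). apply Rmult_lt_0_compat; lra.
        rewrite Rmult_assoc, Rinv_l by (apply Rgt_not_eq, Rmult_lt_0_compat; lra). lra. }
      apply Rle_trans with ((CG + CB) * (Hk2 * / (INR N * (r - l)))).
      assert (CB * 1 <= (CG + CB) * (Hk2 * / (INR N * (r - l))))
        by (apply Rmult_le_compat; lra).
      lra.
      assert (0 <= (CG + CB) * Hk2) by (apply Rmult_le_pos; lra). lra.
  (* [delta] is here the distance of the cell to 0. It is at most [|x|] throughout the cell, so the
     a priori weight at [x] dominates the power of this [tau]. *)
  - apply (Good (sqrt eps + delta)). lra. lra. nra.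
    + intros x Hx. specialize (Sx x ltac:(lra)). lra.
    + intros x Hx. specialize (Sx x ltac:(lra)).
      destruct (B x ltac:(lra)) as [Bx _].
      apply Rle_trans with (2 := Bx (S (S k)) ltac:(lia)).
      apply Rmult_le_compat_r. apply Rabs_pos. apply pow_incr; lra.
Qed.

Theorem theorem4p3 :
  forall k : nat, (1 <= k)%nat ->
  exists m N0 : nat,
  forall (a b c f : R -> R) (gamma lambda cinv Cdelta : R),
    class_C m a -> class_C m c -> class_C m f ->
    continuous_I b ->
    (forall x : R, -1 <= x <= 1 -> a x = - x * b x /\ 0 < b x) ->
    (forall x : R, -1 <= x <= 1 -> 0 <= c x) ->
    0 < c 0 ->
    0 < gamma ->
    (forall x : R, -1 <= x <= 1 -> gamma <= c x - 1 / 2 * Derive a x) ->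
    0 < lambda ->
    (lambda < lambda_bar a c
     \/ (lambda = lambda_bar a c /\ ~ is_integer (lambda_bar a c))) ->
    lambda < INR (k + 1) ->
    a_priori_bounds a c f k lambda ->
    0 < cinv ->
  exists C1 C2 : R, 0 < C1 /\ 0 < C2 /\
  forall (eps : R) (N : nat),
    0 < eps <= 1 -> (0 < N)%nat -> (N0 <= N)%nat ->
    Nat.divide (mesh_K k lambda eps N + 1) N ->
    inverse_inequality cinv k N (mesh k lambda eps N) ->
  forall (delta : Z -> R) (u uN : R -> R),
    delta_coercivity eps gamma cinv c k N (mesh k lambda eps N) delta ->
    delta_size eps Cdelta N (mesh k lambda eps N) delta ->
    bvp_solution eps a c f u ->
    sd_solution eps a c f k N (mesh k lambda eps N) delta uN ->
    norm_SD eps a N (mesh k lambda eps N) delta (fun x => u x - uN x)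
      <= C1 * (INR (mesh_K k lambda eps N + 1) * / INR N) ^ k
    /\
    C1 * (INR (mesh_K k lambda eps N + 1) * / INR N) ^ k
      <= C2 * (/ INR N * ln (INR N)) ^ k.
Proof.
  (* From here on the order is [S k]. Data of class [S k] give [u] the [S (S k)] derivatives of the
     Taylor estimate, and 2 is the threshold for [ln_dominates_mesh_K]. *)
  intros k Hk1. destruct k as [|k]; [lia|]. exists (S k), 2%nat.
  intros a b c f gamma lambda cinv Cdelta Ha Hc Hf Hb Hab _ Hc0 Hgamma Hcoer
    Hl _ Hlk Hap Hcinv.
  destruct (a_priori_scaled (S k) a c f lambda Hl Hlk Hap) as (C & HC & HB).
  destruct (bounded_continuous_I b Hb) as (Mb & HMb & Bb).
  destruct (ln_dominates_mesh_K (S k) lambda Hl Hlk) as (Q & HQ & HlnK).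
  assert (Cc : continuous_I c) by (apply (class_C_continuous_I 0 (S k)); auto; lia).
  assert (Hs : forall x, -1 < x < 1 -> Rabs (c x) <= sup_norm c)
    by (intros; now apply sup_norm_upper_bound).
  set (Mc := sup_norm c) in *. assert (Hs0 : 0 < Mc).
  { apply Rlt_le_trans with (2 := Hs 0 ltac:(lra)). apply Rabs_pos_lt; lra. }
  (* [Cdelta] comes without a sign; its absolute value is a nonnegative bound of the same kind. *)
  set (D := Rabs Cdelta). assert (HD : 0 <= D) by apply Rabs_pos.
  set (CT := (2205 + D) * (C * 9 ^ S k) ^ 2 + (45 + D) * C ^ 2).
  assert (HCT : 0 < CT).
  { apply Rplus_lt_0_compat; apply Rmult_lt_0_compat; try lra; apply pow_lt; auto.
    apply Rmult_lt_0_compat; auto; apply pow_lt; lra. }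
  set (KE := 8 * (4 + 2 / gamma + 2 * Mc ^ 2 / gamma + 3 * D + 3 * D * Mc ^ 2)
              / Rmin 1 gamma + 2 * (1 + D)).
  assert (HKE : 0 < KE).
  { assert (Ig : 0 < / gamma) by (apply Rinv_0_lt_compat; lra).
    assert (M2 := pow2_ge_0 Mc).
    assert (0 <= Mc ^ 2 * / gamma) by (apply Rmult_le_pos; lra).
    assert (0 <= D * Mc ^ 2) by (apply Rmult_le_pos; lra).
    unfold KE, Rdiv. apply Rplus_lt_0_compat; [|lra].
    apply Rmult_lt_0_compat. lra. apply Rinv_0_lt_compat, Rmin_glb_lt; lra. }
  (* [KE] comes from the energy estimate, [1 + Mb ^ 2] from replacing [x] by [a], [CT] from one
     cell, and 4 from summing the cell weights. *)
  set (KK := KE * ((1 + Mb ^ 2) * CT * 4)).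
  assert (HKK : 0 < KK).
  { assert (M2 := pow2_ge_0 Mb). unfold KK.
    repeat apply Rmult_lt_0_compat; lra. }
  assert (HsK : 0 < sqrt KK) by (now apply sqrt_lt_R0).
  exists (sqrt KK), (sqrt KK * Q ^ S k).
  split; [exact HsK|]. split. { apply Rmult_lt_0_compat; auto. now apply pow_lt. }
  intros eps N Heps HN HN2 HK Hinv delta u uN Hdc Hds Hu HuN.
  assert (PN : 1 <= INR N) by (apply (le_INR 1); lia).
  assert (IN : 0 < / INR N) by (apply Rinv_0_lt_compat; lra).
  set (K := mesh_K (S k) lambda eps N) in *. set (X := mesh (S k) lambda eps N) in *.
  set (H := INR (K + 1) / INR N). change (INR (K + 1) * / INR N) with H.
  destruct (mesh_ratio K N HN HK) as (_ & H01 & _). fold H in H01.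
  split; cycle 1.
  { rewrite Rmult_assoc. apply Rmult_le_compat_l. lra.
    rewrite <- Rpow_mult_distr. apply pow_incr. split. lra.
    unfold H. assert (L := HlnK eps N Heps HN2). fold K in L.
    apply (Rmult_le_compat_r (/ INR N)) in L; [|lra]. unfold Rdiv. lra. }
  destruct (mesh_endpoints K N HN HK) as [XL XR].
  change (X (- Z.of_nat N)%Z = -1) in XL. change (X (Z.of_nat N) = 1) in XR.
  assert (HX : forall i, cell_index N i ->
    -1 <= X (i - 1)%Z /\ X (i - 1)%Z < X i /\ X i <= 1).
  { intros i Hi. destruct (mesh_cell_shape K N HN HK i Hi) as (X1 & X2 & X3 & _).
    exact (conj X1 (conj X2 X3)). }
  assert (Hdelta : forall i, cell_index N i ->
    0 <= delta i <= D /\ delta i * eps <= D * step X i ^ 2).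
  { intros i Hi. destruct (Hds i Hi) as [d0 d1].
    assert (m0 : 0 <= Rmin 1 (step X i ^ 2 / eps)).
    { apply Rmin_glb. lra. apply Rmult_le_pos. apply pow2_ge_0.
      left; apply Rinv_0_lt_compat; lra. }
    assert (d2 : delta i <= D * Rmin 1 (step X i ^ 2 / eps)).
    { apply Rle_trans with (1 := d1). apply Rmult_le_compat_r; auto. apply Rle_abs. }
    assert (m1 := Rmult_le_compat_l D _ _ HD (Rmin_l 1 (step X i ^ 2 / eps))).
    assert (m2 := Rmult_le_compat_l D _ _ HD (Rmin_r 1 (step X i ^ 2 / eps))).
    split; [lra|].
    apply Rle_trans with (D * (step X i ^ 2 / eps) * eps).
    apply Rmult_le_compat_r; lra. right; field; lra. }
  assert (HuC := solution_C2_cell eps a c f u k (proj1 Heps) Ha Hc Hf Hu).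
  assert (Pu : piecewise_C2 N X u).
  { intros i Hi. destruct (HX i Hi) as (? & ? & ?). now apply (C2_cell_sub (-1) 1). }
  destruct HuC as (uc & _ & _ & Cuc & _ & _ & Euc & _).
  assert (Du := differentiable_is_derive _ _
    (solution_differentiable eps a c f u k (proj1 Heps) Ha Hc Hf Hu)).
  assert (Hu' := Hu). destruct Hu' as (_ & u0 & u1 & _).
  set (CC := fun i => CT * (H ^ S k) ^ 2 * (1 + / (INR N * step X i))).
  destruct (fe_interpolant (S k) N X HN HX XL XR u
    (fun i p => polyfun (S k) p /\ forall x, X (i - 1)%Z < x < X i ->
       interpolation_error eps (delta i) u p x <= CC i) u0 u1) as (uI & HuI & EI).
  { intros i Hi. destruct (Hdelta i Hi) as [d0 d1].
    destruct (mesh_cell_interpolant k N eps lambda C D (delta i) u uc i)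
      as (p & Pp & pl & pr & E); auto.
    - intros j x Hj Hx. apply Du; auto; lia.
    - exists p. auto. }
  assert (Ca1 : class_C 1 a) by (intros j x Hj Hx; apply Ha; auto; lia).
  apply Rle_trans with (sqrt (KE * sum_cells N (fun i =>
    ((1 + Mb ^ 2) * CC i) * (X i - X (i - 1)%Z)))).
  { apply (SD_error_estimate eps gamma D Mc a c (S k) N X delta (proj1 Heps) Hgamma HN
      HX XL XR (fun i Hi => proj1 (Hdelta i Hi)) Ca1 Cc Hs cinv u uN uI); auto.
    - apply HuN.
    - intros w Hw. destruct HuN as [HuN Gal]. rewrite Gal by auto.
      apply (Galerkin_consistency eps a c (S k) N X delta (proj1 Heps) HN HX XL XR Ca1 Cc
        f u w k); auto.
    - intros i x Hi Hx. destruct (EI i Hi) as (p & [Pp Ep] & Eq).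
      destruct (HX i Hi) as (X1 & X2 & X3).
      specialize (Ep x Hx).
      rewrite <- (interpolation_error_ext eps (delta i) _ _ _ u uI p x Pp Eq Hx) in Ep.
      (* [a = -x b] with [|b| <= Mb] compares the two error densities; only the convective term
         picks up [Mb ^ 2]. *)
      apply Rle_trans with ((1 + Mb ^ 2) * interpolation_error eps (delta i) u uI x).
      2: apply Rmult_le_compat_l; auto; generalize (pow2_ge_0 Mb); lra.
      unfold stability_error, interpolation_error.
      destruct (Hab x ltac:(lra)) as [-> _].
      set (e0 := u x - uI x). set (e1 := Derive u x - Derive uI x).
      set (e2 := Derive_n u 2 x - Derive_n uI 2 x).
      assert (B2 : b x ^ 2 <= Mb ^ 2) by (apply sqr_le, Bb; lra).
      destruct (Hdelta i Hi) as [[d0 _] _].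
      assert (P1 := pow2_ge_0 (x * e1)). assert (P2 := pow2_ge_0 e0).
      assert (P3 : 0 <= eps * e1 ^ 2) by (apply Rmult_le_pos; [lra | apply pow2_ge_0]).
      assert (P4 : 0 <= delta i * (eps * e2) ^ 2)
        by (apply Rmult_le_pos; [lra | apply pow2_ge_0]).
      assert (P5 : b x ^ 2 * (x * e1) ^ 2 <= Mb ^ 2 * (x * e1) ^ 2)
        by (apply Rmult_le_compat_r; auto).
      assert (P6 : 0 <= Mb ^ 2 * (eps * e1 ^ 2 + e0 ^ 2 + delta i * (eps * e2) ^ 2))
        by (apply Rmult_le_pos; [apply pow2_ge_0 | lra]).
      replace ((- x * b x * e1) ^ 2) with (b x ^ 2 * (x * e1) ^ 2) by ring.
      lra. }
  rewrite (sum_cells_ext N HN _ (fun i => (1 + Mb ^ 2) * CT * (H ^ S k) ^ 2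
    * ((X i - X (i - 1)%Z) + / INR N))).
  2:{ intros i Hi. destruct (HX i Hi) as (X1 & X2 & X3). unfold CC, step. field. lra. }
  (* The lengths telescope to 2, and the [2 N] copies of [/ N] add another 2. *)
  rewrite <- sum_cells_scal, <- sum_cells_plus, sum_cells_telescope, sum_cells_const by auto.
  rewrite XL, XR. apply Req_le.
  transitivity (sqrt (KK * (H ^ S k) ^ 2)).
  { f_equal. unfold KK. field. lra. }
  rewrite sqrt_mult_alt by lra. rewrite sqrt_pow2. reflexivity. apply pow_le; lra.
Qed.
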